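(* Let $q$ be an odd prime power, $m\geq 2$ and $n=\frac{q^m+1}{2}$. Let $\delta_1,\delta_2,\delta_3$ be the first, second and third largest odd coset leaders modulo $q^m+1$, and let $\kappa=1$ if $q^m\equiv 1\pmod 4$ and $\kappa=2$ if $q^m\equiv 3\pmod 4$. Let $\delta$ be an integer. Then for $i\in\{1,2\}$, if $\frac{\delta_{i+1}+3}{2}\leq\delta\leq\frac{\delta_i+1}{2}$, the negacyclic BCH code $\mathcal{C}_{(q,n,\delta,0)}$ has parameters $[n,\,2m(i-1)+\kappa,\,d\geq\delta_i]$. Moreover, if $q^m\geq 25$, the negacyclic BCH code $\mathcal{C}_{(q,n,(\delta_3+1)/2,0)}$ has parameters $[n,\,4m+\kappa,\,d\geq\delta_3]$.
   Context: For positive integers $N$ and $0\leq i\leq N-1$, the $q$-cyclotomic coset of $i$ modulo $N$ is $C_i^{(q,N)}=\{i,iq,iq^2,\ldots\}\bmod N$; its smallest element is its coset leader. An odd coset leader modulo $N$ is a coset leader which is an odd integer; $\delta_i$ denotes the $i$-th largest one modulo $q^m+1$. Negacyclic BCH codes: for a positive integer $n$ with $\gcd(n,q)=1$, let $\ell$ be the order of $q$ modulo $2n$, $\alpha$ a primitive element of $\mathrm{GF}(q^\ell)$, $\beta=\alpha^{(q^\ell-1)/(2n)}$, and $\mathbb{M}_{\beta^j}(x)$ the minimal polynomial of $\beta^j$ over $\mathrm{GF}(q)$. For $2\leq\delta\leq n$, $\mathcal{C}_{(q,n,\delta,0)}$ is the negacyclic code of length $n$ over $\mathrm{GF}(q)$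 (ideal of $\mathrm{GF}(q)[x]/(x^n+1)$) generated by $\mathrm{lcm}\big(\mathbb{M}_{\beta^{1}}(x),\mathbb{M}_{\beta^{3}}(x),\ldots,\mathbb{M}_{\beta^{1+2(\delta-2)}}(x)\big)$. Parameters $[n,k,d]$ are length, dimension, minimum Hamming distance. *)

(* Defs.v *)
From HB Require Import structures.
From mathcomp Require Import all_boot all_order all_algebra all_field.
Set Implicit Arguments. Unset Strict Implicit. Unset Printing Implicit Defensive.
Import GRing.Theory.
Local Open Scope ring_scope.

(* i (< N) is the coset leader of its q-cyclotomic coset modulo N, i.e. i is
   the smallest element of {i q^k mod N : k >= 0}.  The exponents k < N
   already exhaust the coset (the sequence q^k mod N is determined by its
   previous term, so all its values occur among the first N terms). *)
Definition coset_leader (q N i : nat) : bool :=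
  (i < N)%N && [forall k : 'I_N, (i <= (i * q ^ k) %% N)%N].

Definition odd_coset_leaders (q N : nat) : seq nat :=
  [seq i <- iota 0 N | odd i && coset_leader q N i].

Definition delta (q N j : nat) : nat := nth 0%N (rev (odd_coset_leaders q N)) j.-1.

Definition is_order_mod (q N l : nat) : Prop :=
  (0 < l)%N /\ q ^ l = 1 %[mod N] /\
  (forall k, (0 < k < l)%N -> q ^ k <> 1 %[mod N]).

Definition lcmp (K : fieldType) (p r : {poly K}) : {poly K} := (p * r) %/ gcdp p r.

Section NegacyclicBCH.
Variables (F : finFieldType) (L : fieldExtType F).

Definition word_poly (n : nat) (c : 'rV[F]_n) : {poly F} :=
  \sum_(i < n) (c ord0 i)%:P * 'X^i.

(* lcm(M_{beta^1}(x), M_{beta^3}(x), ..., M_{beta^{1+2(delta-2)}}(x)), where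
   M_y = minPoly 1 y is the minimal polynomial of y over the base field GF(q)
   (a polynomial with coefficients in GF(q)*1, written in L[x]). *)
Definition bch_generator (beta : L) (dlt : nat) : {poly L} :=
  \big[@lcmp L/1]_(j < dlt.-1) minPoly 1%VS (beta ^+ (2 * j + 1)).

(* c belongs to the ideal of GF(q)[x]/(x^n+1) generated by the generator
   polynomial g (g divides x^n+1, so this ideal consists of the residues of
   degree < n that are multiples of g; divisibility is tested in L[x], which
   for polynomials with coefficients in GF(q) is the same as in GF(q)[x]). *)
Definition in_bch_code (beta : L) (n dlt : nat) (c : 'rV[F]_n) : bool :=
  bch_generator beta dlt %| map_poly (in_alg L) (word_poly c).

(* the code C_(q,n,dlt,0) as a GF(q)-subspace of GF(q)^n (the span of its
   codewords, which is the set of codewords itself) *)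
Definition bch_code (beta : L) (n dlt : nat) : {vspace 'rV[F]_n} :=
  <<[seq c <- enum 'rV[F]_n | in_bch_code beta dlt c]>>%VS.

End NegacyclicBCH.

Definition weight (F : finFieldType) (n : nat) (c : 'rV[F]_n) : nat :=
  #|[set i : 'I_n | c ord0 i != 0]|.

(* Main.v *)
(** Put N = q^m + 1 = 2n. Since n q = n mod N and q^m = -1 mod N, an integer i <= n is a
    coset leader iff j = n - i dominates the absolutely least residues of all j q^k, so the
    largest odd leaders correspond to the smallest such j with j odd iff n is even. If n is
    odd (q^m = 1 mod 4) the first one is j = 0; if n is even, then m is odd and it is
    j = N/(q+1), on which q acts as -1. Any other coset with fewer than 2m elements comes
    from an orbit t modulo q^d + 1, with m/d odd and m >= 3d, rescaled by N/(q^d + 1).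
    Lower bounds for such t show that they lie above two explicit values of j, so that the
    cosets of the second and third leaders have 2m elements. The code is cut out by the
    zeros beta^r, r odd outside the first i cosets; its generator has coefficients in F, so
    the dimension is the number of nonzeros, and the zeros beta^r for r = -(delta_i - 2),
    ..., delta_i - 2 in steps of 2 give the weight bound. *)

Require Import Defs.
From HB Require Import structures.
From mathcomp Require Import all_boot all_order all_algebra all_field.
From mathcomp Require Import pgroup abelian.
From mathcomp Require Import zify ring.
Import Order.TTheory GRing.Theory Num.Theory.
Local Open Scope ring_scope.

(** * Orbits modulo q^m + 1 *)

(** The second and third leaders are never computed: explicit leaders only bound them from below,
    and every odd leader from the lower witness up to the first leader, itself excluded, is shown to
    have a full coset. This forces the bounds on short orbits to reach past the witnesses. The
    parity of n splits the argument because the scale e = N / (q^d + 1) is odd, so that t has the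
    parity of n - i: even for odd n, odd for even n. An even t satisfies t > q^(d-1), which suffices
    directly. Among the odd t there is the point on which q acts as -1, and orbits may come close
    above it; there the estimate agrees with the witness in its main term, and divisibility by q
    decides the comparison. The condition q^m >= 25 only removes q = 3, m = 2, where n leaves no
    room for the third witness. *)

(* The absolutely least residues of all x q^k modulo N are at most B. *)
Definition orbit_le (q N B x : int) : Prop :=
  forall k : nat, exists s : int, `|x * q ^+ k - N * s| <= B.

Lemma orbit_le_half (q N B x : int) (m : nat) :
  N = q ^+ m + 1 -> (0 < m)%N ->
  (forall k, (k < m)%N -> exists s : int, `|x * q ^+ k - N * s| <= B) ->
  orbit_le q N B x.
Proof.
move=> defN m_gt0 small k.
elim/ltn_ind: k => k IH; have [/small // | le_m_k] := ltnP k m.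
have [|s Hs] := IH (k - m)%N; first lia.
exists (x * q ^+ (k - m) - s); rewrite -normrN.
suff -> : - (x * q ^+ k - N * (x * q ^+ (k - m) - s)) = x * q ^+ (k - m) - N * s by [].
by rewrite -{1}(subnK le_m_k) exprD defN; ring.
Qed.

Lemma orbit_le_expr (q N B x y s : int) (k : nat) :
  orbit_le q N B x -> `|y| = `|x * q ^+ k - N * s| -> orbit_le q N B y.
Proof.
move=> ox eqy h; have [r Hr] := ox (k + h)%N.
have [->|->] : y = x * q ^+ k - N * s \/ y = - (x * q ^+ k - N * s) by lia.
  exists (r - s * q ^+ h).
  by move: Hr; rewrite exprD => Hr; move: Hr; congr (`|_| <= _); ring.
exists (s * q ^+ h - r); rewrite -normrN.
by move: Hr; rewrite exprD => Hr; move: Hr; congr (`|_| <= _); ring.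
Qed.

(** Since q t > t, some positive multiple of N must be subtracted from q t, and the result is at
    least -t. *)
Lemma orbit_le_fixed_point (q N t : int) :
  1 < q -> 0 < N -> 0 < t -> orbit_le q N t t -> N <= (q + 1) * t.
Proof.
move=> q_gt1 N_gt0 t_gt0 /(_ 1%N) [s]; rewrite expr1 => Hs.
have s_gt0 : 0 < s by nia.
nia.
Qed.


(* If t <= q^(d-1), each step of the orbit either multiplies the residue by q or subtracts
   +-M as well, which changes its sign. The invariant says that the accumulated multiple s
   of M has the parity of the number of sign changes; as q^d = -1, after d steps s = t
   and the sign is opposite, so t is odd. *)
Lemma even_orbit_max (q t : int) (d : nat) :
  3 <= q -> (exists u, q = 2 * u + 1) -> (0 < d)%N ->
  0 < t -> (exists u, t = 2 * u) ->
  orbit_le q (q ^+ d + 1) t t -> q ^+ d.-1 < t.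
Proof.
move=> q_ge3 [w q_odd] d_gt0 t_gt0 [u t_even] ot; rewrite ltNge; apply/negP => t_le.
have defM : q ^+ d = q * q ^+ d.-1 by rewrite -exprS prednK.
have qt_le : q * t <= q ^+ d by rewrite defM ler_pM2l //; lia.
have defM1 : q ^+ d = (q ^+ d + 1) - 1 by ring.
set M := q ^+ d + 1 in ot defM1 *.
have M_gt0 : 0 < M by lia.
have qt_lt : q * t < M by lia.
clear defM.
have q3t : 3 * t <= q * t by rewrite ler_pM2r.
have step k : exists s : int, `|t * q ^+ k - M * s| <= t /\
   ((exists v, s = 2 * v) /\ 0 < t * q ^+ k - M * s \/
    (exists v, s = 2 * v + 1) /\ t * q ^+ k - M * s < 0).
  elim: k => [|k [s [Hs sgn]]].
    exists 0; rewrite expr0; split; first by rewrite mulr0 subr0 mulr1; lia.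
    by left; split; [exists 0 | lia].
  have [r Hr] := ot k.+1; exists r; split=> //.
  rewrite exprS in Hr *.
  have eqx : t * (q * q ^+ k) - M * r = q * (t * q ^+ k - M * s) - M * (r - q * s) by ring.
  have r_def : r = (r - q * s) + q * s by ring.
  move: (r - q * s) eqx r_def => v eqx r_def.
  rewrite {}eqx in Hr *.
  move: (t * q ^+ k - M * s) Hs sgn Hr => x Hs sgn Hr.
  have qx_le : `|q * x| <= q * t by rewrite normrM ger0_norm ?ler_pM2l; lia.
  have v_le1 : v <= 1.
    rewrite leNgt; apply/negP => v_ge2.
    have : 0 <= M * (v - 2) by apply: mulr_ge0; lia.
    lia.
  have v_geN1 : -1 <= v.
    rewrite leNgt; apply/negP => v_ltN1.
    have : 0 <= M * (-2 - v) by apply: mulr_ge0; lia.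
    lia.
  have v_eq : v = 0 \/ v = 1 \/ v = -1 by lia.
  case: sgn => [[[a s_eq] x_gt0]|[[a s_eq] x_lt0]].
    have qx_gt0 : 0 < q * x by apply: mulr_gt0; lia.
    case: v_eq => [v_eq|[v_eq|v_eq]]; [left|right|lia]; split; try lia.
      by exists (q * a); rewrite r_def v_eq s_eq; ring.
    by exists (q * a); rewrite r_def v_eq s_eq; ring.
  have qx_lt0 : q * x < 0 by rewrite pmulr_rlt0; lia.
  case: v_eq => [v_eq|[v_eq|v_eq]]; [right|lia|left]; split; try lia.
    by exists (q * a + w); rewrite r_def v_eq s_eq q_odd; ring.
  by exists (q * a + w); rewrite r_def v_eq s_eq q_odd; ring.
have [s []] := step d.
have -> : t * q ^+ d - M * s = M * (t - s) - t by rewrite /M; ring.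
move=> Hs; have ts0 : t - s = 0.
  have [ts_le0|ts_gt0] := lerP (t - s) 0.
    have [?|?] := eqVneq (t - s) 0; first by [].
    have : 0 <= M * (- (t - s) - 1) by apply: mulr_ge0; lia.
    lia.
  have : 0 <= M * ((t - s) - 1) by apply: mulr_ge0; lia.
  lia.
by rewrite ts0 mulr0; case=> [[[a ?]]|[[a ?]]]; lia.
Qed.

(* Otherwise the absolute residues would lie alternately above and below the fixed point
   M / (q + 1), which contradicts the odd period d. *)
Lemma odd_period_orbit_max (q t : int) (d : nat) :
  3 <= q -> odd d -> q ^+ d + 1 < (q + 1) * t ->
  orbit_le q (q ^+ d + 1) t t ->
  (q ^+ 2 + q - 1) * (q ^+ d + 1) <= q ^+ 2 * (q + 1) * t.
Proof.
move=> q_ge3 d_odd t_gt ot; rewrite leNgt; apply/negP => t_lt.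
have Md : q ^+ d = (q ^+ d + 1) - 1 by ring.
have Qd_gt0 : 0 < q ^+ d by apply: exprn_gt0; lia.
set M := q ^+ d + 1 in Md ot t_gt t_lt *.
have M_gt0 : 0 < M by lia.
have t_gt0 : 0 < t by nia.
rewrite expr2 in t_lt.
(* The constant q^2 + q - 1 is chosen for this: the residue M - q t following t exceeds M / (q (q +
   1)), so that one more factor q brings it back above the fixed point M / (q + 1). *)
have qt_lt' : (q + 1) * q * (M - q * t) > M by lia.
have qt_lt : q * t < M by nia.
clear Md; have step k : exists s : int, `|t * q ^+ k - M * s| <= t /\
  if odd k then M < q * (q + 1) * `|t * q ^+ k - M * s| /\ (q + 1) * `|t * q ^+ k - M * s| < M
  else M < (q + 1) * `|t * q ^+ k - M * s|.
  elim: k => [|k [s [Hs Hx]]].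
    by exists 0; rewrite expr0 mulr1 mulr0 subr0 /= ger0_norm //; lia.
  have [r Hr] := ot k.+1; exists r; split=> //; move: Hr; rewrite exprS.
  have -> : t * (q * q ^+ k) - M * r = q * (t * q ^+ k - M * s) - M * (r - q * s) by ring.
  move: (t * q ^+ k - M * s) (r - q * s) Hs Hx => {}x v Hs H Hr /=.
  have [v' Ev] : exists v', `|q * x - M * v| = `|q * `|x| - M * v'|.
    have [x_ge0|x_lt0] := ger0P x; first by exists v.
    by exists (- v); rewrite -normrN; congr `|_|; ring.
  rewrite Ev in Hr *; move: Hr Hs H; have := normr_ge0 x.
  move: `|x| => y y_ge0 Hr Hs.
  clear -q_ge3 M_gt0 t_gt0 t_gt qt_lt qt_lt' y_ge0 Hr Hs.
  have qy_le : q * y <= q * t by rewrite ler_pM2l //; lia.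
  case: (odd k) => /=.
    case=> lo hi; have qhi : q * ((q + 1) * y) < q * M by rewrite ltr_pM2l //; lia.
    have [v_le0|v_gt0] := lerP v' 0.
      have : 0 <= M * - v' by apply: mulr_ge0; lia.
      have : (q + 1) * (q * y - M * v') <= (q + 1) * `|q * y - M * v'|.
        by rewrite ler_pM2l ?ler_norm; lia.
      have : 0 <= (q + 1) * (M * - v') by apply: mulr_ge0; nia.
      lia.
    have : 0 <= (q + 1) * (M * (v' - 1)) by apply: mulr_ge0; nia.
    have : (q + 1) * (M * v' - q * y) <= (q + 1) * `|q * y - M * v'|.
      by rewrite distrC ler_pM2l ?ler_norm; lia.
    lia.
  move=> lo.
  have v'1 : v' = 1.
    have [v_le0|v_gt0] := lerP v' 0.
      have Mv : 0 <= M * - v' by apply: mulr_ge0; lia.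
      have qyt : (q + 1) * (q * y) <= (q + 1) * t by rewrite ler_pM2l; lia.
      have qM : q * M < q * ((q + 1) * y) by rewrite ltr_pM2l //; lia.
      have qtM : (q + 1) * (q * t) < (q + 1) * M by rewrite ltr_pM2l //; lia.
      have q3t : 3 * ((q + 1) * t) <= q * ((q + 1) * t).
        by rewrite ler_pM2r //; apply: mulr_gt0; lia.
      have q3M : 3 * M <= q * M by rewrite ler_pM2r.
      lia.
    have [v_ge2|v_lt2] := lerP 2 v'; last lia.
    have : 0 <= M * (v' - 2) by apply: mulr_ge0; lia.
    have : 3 * t <= q * t by rewrite ler_pM2r.
    lia.
  rewrite v'1 ler0_norm; last lia.
  have : (q + 1) * q * (M - q * t) <= (q + 1) * q * (M - q * y).
    by rewrite ler_pM2l; [lia | apply: mulr_gt0; lia].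
  have : q * M < q * ((q + 1) * y) by rewrite ltr_pM2l //; lia.
  lia.
have [s []] := step d; rewrite d_odd.
have -> : t * q ^+ d - M * s = M * (t - s) - t by rewrite /M; ring.
move=> H1 [_].
have tM : 3 * t <= q * t by rewrite ler_pM2r.
have -> : t - s = 0.
  have [ts_le0|ts_gt0] := lerP (t - s) 0.
    have [?|?] := eqVneq (t - s) 0; first by [].
    have : 0 <= M * (- (t - s) - 1) by apply: mulr_ge0; lia.
    lia.
  have : 0 <= M * ((t - s) - 1) by apply: mulr_ge0; lia.
  lia.
rewrite mulr0 sub0r normrN ger0_norm; lia.
Qed.

(** * Explicit integers that dominate their own orbit *)

(** As q^m = -1, the other residues are q^(k+1) - q^k with k + 1 <= m - 1. This gives the second
    witness for odd n. *)
Lemma orbit_le_pow_succ (q : int) (m : nat) :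
  3 <= q -> (0 < m)%N ->
  orbit_le q (q ^+ m + 1) (q ^+ m.-1 + 1) (q ^+ m.-1 + 1).
Proof.
move=> q_ge3 m_gt0; apply: (@orbit_le_half _ _ _ _ m) => //.
case=> [|k] k_lt.
  exists 0; rewrite expr0 mulr1 mulr0 subr0 ger0_norm //.
  by apply: addr_ge0 => //; apply: exprn_ge0; lia.
exists (q ^+ k).
have -> : (q ^+ m.-1 + 1) * q ^+ k.+1 - (q ^+ m + 1) * q ^+ k = q ^+ k.+1 - q ^+ k.
  by rewrite -{2}(prednK m_gt0) !exprS; ring.
have le1 : q ^+ k <= q ^+ k.+1 by rewrite ler_eXn2l //; lia.
have le2 : q ^+ k.+1 <= q ^+ m.-1 by rewrite ler_eXn2l //; lia.
have : 0 < q ^+ k by apply: exprn_gt0; lia.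
lia.
Qed.

(** The other residues are q^(k+2) - q^k until the second term also wraps round, which happens at k
    = m - 2 and leaves -(1 + q^(m-2)). This gives the third witness for odd n. *)
Lemma orbit_le_pow_add (q : int) (m : nat) :
  3 <= q -> (1 < m)%N ->
  orbit_le q (q ^+ m + 1) (q ^+ m.-1 + q) (q ^+ m.-1 + q).
Proof.
move=> q_ge3 m_gt1; apply: (@orbit_le_half _ _ _ _ m); [by []|lia|].
have Q_gt0 : 0 < q ^+ m.-1 by apply: exprn_gt0; lia.
have qm : q ^+ m = q * q ^+ m.-1 by rewrite -exprS prednK; lia.
case=> [|k] k_lt.
  by exists 0; rewrite expr0 mulr1 mulr0 subr0 ger0_norm //; lia.
have Qk_gt0 : 0 < q ^+ k by apply: exprn_gt0; lia.
have [k_eq|k_lt'] : (k = m.-2 \/ k.+2 <= m.-1)%N by lia.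
  have mk : q ^+ m.-1 = q * q ^+ k by rewrite k_eq -exprS; congr (_ ^+ _); lia.
  exists (q ^+ k + 1).
  have -> : (q ^+ m.-1 + q) * q ^+ k.+1 - (q ^+ m + 1) * (q ^+ k + 1) = - (1 + q ^+ k).
    by rewrite qm exprS mk; ring.
  have : 3 * q ^+ k <= q * q ^+ k by rewrite ler_pM2r.
  rewrite normrN; lia.
exists (q ^+ k).
have -> : (q ^+ m.-1 + q) * q ^+ k.+1 - (q ^+ m + 1) * q ^+ k = q ^+ k.+2 - q ^+ k.
  by rewrite qm !exprS; ring.
have le1 : q ^+ k <= q ^+ k.+2 by rewrite ler_eXn2l //; lia.
have le2 : q ^+ k.+2 <= q ^+ m.-1 by rewrite ler_eXn2l //; lia.
lia.
Qed.

Lemma orbit_le_geom3 (q : int) :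
  3 <= q -> orbit_le q (q ^+ 3 + 1) (q ^+ 2 + q + 1) (q ^+ 2 + q + 1).
Proof.
move=> q_ge3; apply: (@orbit_le_half _ _ _ _ 3) => // k k_lt.
have qq : 0 < q * q by apply: mulr_gt0; lia.
have qq3 : 3 * q <= q * q by rewrite ler_pM2r; lia.
have [->|[->|->]] : k = 0%N \/ k = 1%N \/ k = 2%N by lia.
- by exists 0; rewrite expr0 mulr1 mulr0 subr0 ger0_norm // expr2; lia.
- exists 1.
  have -> : (q ^+ 2 + q + 1) * q ^+ 1 - (q ^+ 3 + 1) * 1 = q ^+ 2 + q - 1 by ring.
  rewrite expr2; lia.
- exists (q + 1).
  have -> : (q ^+ 2 + q + 1) * q ^+ 2 - (q ^+ 3 + 1) * (q + 1) = q ^+ 2 - q - 1 by ring.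
  rewrite expr2; lia.
Qed.

Lemma expr_mod_succ (q : int) (k : nat) :
  exists c : int, q ^+ k = (q + 1) * c + (-1) ^+ odd k.
Proof.
elim: k => [|k [c IH]]; first by exists 0; rewrite expr0 mulr0 add0r.
exists (q * c + (-1) ^+ odd k); rewrite exprS IH /=.
by case: (odd k); rewrite ?expr0 ?expr1 /=; ring.
Qed.

(* In base q with digits -1, 0, 1, the alternating word 1 -1 1 ... 1 represents
   A = (q^m + 1) / (q + 1). The number G of the proof is obtained from it by replacing
   the last 2w + 1 digits 1 -1 ... 1 by 0 1 -1 ... -1 1 0, and T is the largest absolute
   residue in the orbit of G. *)
Lemma orbit_le_alternating (q T : int) (m w : nat) :
  3 <= q -> odd m -> (0 < w)%N -> (w.*2 < m)%N ->
  (q + 1) * T = q ^+ m + 1 + (q - 1) * (q ^+ m.-2 + q ^+ (w.*2).-2) ->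
  orbit_le q (q ^+ m + 1) T T.
Proof.
move=> q_ge3 m_odd w_gt0 w_lt defT; set N := q ^+ m + 1 in defT *.
have [cm Em] := expr_mod_succ q m; rewrite m_odd expr1 in Em.
have [cw Ew] := expr_mod_succ q w.*2; rewrite odd_double expr0 in Ew.
pose G := cm - (q - 1) * cw.
have defG : (q + 1) * G = N - (q - 1) * (q ^+ w.*2 - 1).
  by rewrite /N Ew Em /G; ring.
have powle a b : (a <= b)%N -> q ^+ a <= q ^+ b.
  by move=> ?; rewrite ler_eXn2l //; lia.
have qpos k : 0 < q ^+ k by apply: exprn_gt0; lia.
have defqm : q ^+ m = N - 1 by rewrite /N; ring.
have qm1 : q * q ^+ m.-1 = N - 1 by rewrite -defqm -exprS prednK; lia.
have Tpos : 0 < (q - 1) * (q ^+ m.-2 + q ^+ (w.*2).-2).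
  by apply: mulr_gt0; [lia | have := qpos m.-2; have := qpos (w.*2).-2; lia].
have small (k : nat) : (k < m)%N -> exists s : int,
   (q + 1) * `|G * q ^+ k - N * s| <= (q + 1) * T /\
   (k = m.-2 -> (q + 1) * (G * q ^+ k - N * s) = (q + 1) * T).
  move=> k_lt.
  have [c Ek] := expr_mod_succ q k.
  have eqG : (q + 1) * (G * q ^+ k) = N * q ^+ k - (q - 1) * (q ^+ (k + w.*2) - q ^+ k).
    by rewrite mulrA defG exprD; ring.
  have norm (s : int) : (q + 1) * `|G * q ^+ k - N * s| = `|(q + 1) * (G * q ^+ k - N * s)|.
    by rewrite normrM ger0_norm //; lia.
  have [kw_lt|kw_ge] := ltnP (k + w.*2) m.
    have X_ge0 : 0 <= (q - 1) * (q ^+ (k + w.*2) - q ^+ k).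
      by apply: mulr_ge0; [lia | have := powle k (k + w.*2)%N; lia].
    exists c; rewrite norm; split; last by lia.
    have -> : (q + 1) * (G * q ^+ k - N * c) =
       N * (-1) ^+ odd k - (q - 1) * (q ^+ (k + w.*2) - q ^+ k).
      by rewrite mulrBr eqG {1}Ek; ring.
    case: (boolP (odd k)) => k_odd; rewrite ?expr0 ?expr1.
      have le : (q - 1) * q ^+ (k + w.*2) <= (q - 1) * q ^+ m.-2.
        by rewrite ler_pM2l; [apply: powle | ]; lia.
      have := mulr_gt0 (_ : 0 < q - 1) (qpos k).
      have := mulr_gt0 (_ : 0 < q - 1) (qpos (w.*2).-2).
      lia.
    have le : (q - 1) * q ^+ (k + w.*2) <= (q - 1) * q ^+ m.-1.
      by rewrite ler_pM2l; [apply: powle | ]; lia.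
    have := mulr_gt0 (_ : 0 < q - 1) (qpos k).
    have := qpos m.-1.
    lia.
  (* Here q^(k+2w) wraps round to -q^k'. For odd k, q + 1 times the residue is N + (q - 1)(q^k' +
     q^k), which grows with k and reaches (q + 1) T at k = m - 2. For even k, N enters with the
     opposite sign. *)
  have [k' defk'] : exists k', (k + w.*2 = m + k')%N by exists (k + w.*2 - m)%N; lia.
  have [c' Ek'] := expr_mod_succ q k'.
  have k'odd : odd k' = ~~ odd k by lia.
  have q1pos : 0 < q - 1 by lia.
  rewrite defk' exprD defqm in eqG.
  case: (boolP (odd k)) => k_odd.
    rewrite k'odd k_odd /= expr0 in Ek'; rewrite k_odd expr1 in Ek.
    exists (c - (q - 1) * c' - 1).
    have val : (q + 1) * (G * q ^+ k - N * (c - (q - 1) * c' - 1)) =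
        N + (q - 1) * (q ^+ k' + q ^+ k).
      rewrite mulrBr eqG.
      have -> : N * q ^+ k - (q - 1) * ((N - 1) * q ^+ k' - q ^+ k) -
       (q + 1) * (N * (c - (q - 1) * c' - 1)) =
       N * (q ^+ k - (q + 1) * c) - (q - 1) * N * (q ^+ k' - (q + 1) * c') + (q + 1) * N + (q - 1) * (q ^+ k' + q ^+ k) by ring.
      by rewrite {1}Ek {1}Ek'; ring.
    rewrite norm val defT; split.
      have le : (q - 1) * (q ^+ k' + q ^+ k) <= (q - 1) * (q ^+ m.-2 + q ^+ (w.*2).-2).
        rewrite ler_pM2l // addrC; apply: lerD; apply: powle; lia.
      have := mulr_gt0 q1pos (qpos k); have := mulr_gt0 q1pos (qpos k').
      have := qpos m.
      lia.
    move=> k_eq; rewrite k_eq (_ : k' = (w.*2).-2); [ring | lia].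
  rewrite k'odd k_odd /= expr1 in Ek'; rewrite (negbTE k_odd) expr0 in Ek.
  exists (c - (q - 1) * c' + 1).
  have val : (q + 1) * (G * q ^+ k - N * (c - (q - 1) * c' + 1)) =
      - N + (q - 1) * (q ^+ k' + q ^+ k).
    rewrite mulrBr eqG.
    have -> : N * q ^+ k - (q - 1) * ((N - 1) * q ^+ k' - q ^+ k) -
       (q + 1) * (N * (c - (q - 1) * c' + 1)) =
       N * (q ^+ k - (q + 1) * c) - (q - 1) * N * (q ^+ k' - (q + 1) * c') - (q + 1) * N + (q - 1) * (q ^+ k' + q ^+ k) by ring.
    by rewrite {1}Ek {1}Ek'; ring.
  rewrite norm val; split; last by lia.
  have le1 : (q - 1) * q ^+ k <= (q - 1) * q ^+ m.-1.
    by rewrite ler_pM2l; [apply: powle | ]; lia.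
  have le2 : (q - 1) * q ^+ k' <= (q - 1) * q ^+ m.-2.
    by rewrite ler_pM2l; [apply: powle | ]; lia.
  have : q * q ^+ m.-2 = q ^+ m.-1 by rewrite -exprS; congr (_ ^+ _); lia.
  have := mulr_gt0 q1pos (qpos k); have := mulr_gt0 q1pos (qpos k').
  have := qpos m.-2.
  lia.
have q1_gt0 : 0 < q + 1 by lia.
have oG : orbit_le q N T G.
  apply: (@orbit_le_half _ _ _ _ m); [by []|lia|] => k /small [s [Hs _]].
  by exists s; rewrite ler_pM2l in Hs.
have [|s [_ /(_ erefl) Hs]] := small m.-2; first lia.
apply: (@orbit_le_expr _ _ _ G T s m.-2) => //.
by move/(mulfI (lt0r_neq0 q1_gt0)): Hs => ->.
Qed.

(** * Lower bounds for rescaled short orbits *)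

Lemma orbit_le_quotient (q M e t : int) :
  0 < e -> orbit_le q (e * M) (e * t) (e * t) -> orbit_le q M t t.
Proof.
move=> e_gt0 ot k; have [s Hs] := ot k; exists s.
have eq : e * t * q ^+ k - e * M * s = e * (t * q ^+ k - M * s) by ring.
by rewrite eq normrM gtr0_norm // ler_pM2l in Hs.
Qed.

(** From t >= q^(d-1) + 1 it is enough to compare (q^m + 1)(q^(d-1) + 1) with (q^(m-1) + q)(q^d +
    1). The leading terms cancel, and q^m outweighs q^(m-1) + q^(d+1) + q because d + 1 <= m - 1. *)
Lemma orbit_max_short_even (q e t : int) (m d : nat) :
  3 <= q -> (exists u, q = 2 * u + 1) -> (0 < d)%N -> (d * 3 <= m)%N ->
  0 < e -> e * (q ^+ d + 1) = q ^+ m + 1 ->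
  0 < t -> (exists u, t = 2 * u) ->
  orbit_le q (q ^+ m + 1) (e * t) (e * t) -> q ^+ m.-1 + q < e * t.
Proof.
move=> q_ge3 q_odd d_gt0 dm e_gt0 eM t_gt0 t_even; rewrite -eM => /(orbit_le_quotient _ _ _ _ e_gt0).
move=> /(even_orbit_max _ _ _ q_ge3 q_odd d_gt0 t_gt0 t_even) t_gt.
have qpos k : 0 < q ^+ k by apply: exprn_gt0; lia.
have M_gt0 : 0 < q ^+ d + 1 by have := qpos d; lia.
rewrite -(ltr_pM2r M_gt0).
have -> : e * t * (q ^+ d + 1) = e * (q ^+ d + 1) * t by ring.
rewrite eM.
have : (q ^+ m + 1) * (q ^+ d.-1 + 1) <= (q ^+ m + 1) * t.
  by rewrite ler_pM2l; have := qpos m; lia.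
have qm : q ^+ m = q * q ^+ m.-1 by rewrite -exprS prednK; lia.
have : 3 * q ^+ m.-1 <= q * q ^+ m.-1 by rewrite ler_pM2r // qpos.
have : q ^+ d.+1 <= q ^+ m.-1 by rewrite ler_eXn2l; lia.
have : q ^+ 1 <= q ^+ m.-1 by rewrite ler_eXn2l; lia.
have : q ^+ m.-1 * q ^+ d = q ^+ m * q ^+ d.-1 by rewrite -!exprD; congr (_ ^+ _); lia.
have := qpos d.-1; have := qpos m.-1.
rewrite (exprS _ d) expr1; lia.
Qed.

(** For d = 1 the excluded value is t = 1, so t >= 3. For d >= 3 put a = (q^d + 1) / (q + 1); then
    q^2 t >= (q^2 + q - 1) a. Scaled by e (q + 1), this has the same main term (q^2 + q - 1)(q^m +
    1) as q^2 times the claimed bound, which exceeds it by (q - 1)(q^4 - 1). Strictness improves the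
    estimate by 1, hence by (q + 1) e after scaling, and e >= q^4 is enough. *)
Lemma orbit_max_short_odd (q e t : int) (m d : nat) :
  3 <= q -> odd d -> odd m -> (d * 3 <= m)%N ->
  0 < e -> e * (q ^+ d + 1) = q ^+ m + 1 ->
  0 < t -> (exists u, t = 2 * u + 1) -> (q + 1) * (e * t) != q ^+ m + 1 ->
  orbit_le q (q ^+ m + 1) (e * t) (e * t) ->
  q ^+ m + 1 + (q - 1) * (q ^+ m.-2 + q ^+ 2) < (q + 1) * (e * t) /\
  (m = 3%N -> q ^+ 2 + q + 1 < e * t).
Proof.
move=> q_ge3 d_odd m_odd dm e_gt0 eM t_gt0 [u t_odd] ne; rewrite -eM => /(orbit_le_quotient _ _ _ _ e_gt0) ot.
have qpos k : 0 < q ^+ k by apply: exprn_gt0; lia.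
have powle a b : (a <= b)%N -> q ^+ a <= q ^+ b.
  by move=> ?; rewrite ler_eXn2l //; lia.
have q3 k : 3 * q ^+ k <= q * q ^+ k by rewrite ler_pM2r // qpos.
have M_gt0 : 0 < q ^+ d + 1 by have := qpos d; lia.
have qm : q ^+ m = q * (q * q ^+ m.-2) by rewrite -!exprS; congr (_ ^+ _); lia.
have [d1|d_ge3] : d = 1%N \/ (3 <= d)%N by lia.
  rewrite d1 expr1 in eM.
  have t_ge3 : 3 <= t.
    have [t1|] := eqVneq t 1; last lia.
    by case/eqP: ne; rewrite t1 mulr1 mulrC.
  have bnd : 3 * (q ^+ m + 1) <= (q + 1) * (e * t).
    have -> : (q + 1) * (e * t) = t * (e * (q + 1)) by ring.
    by rewrite eM ler_pM2r //; have := qpos m; lia.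
  split=> [|m3].
    rewrite d1 expr1 eM.
    have := powle 1%N m.-2; have := q3 m.-2; have := qpos m.-2.
    rewrite qm in bnd *; rewrite expr2 expr1.
    have : 3 * (q * q ^+ m.-2) <= q * (q * q ^+ m.-2).
      by rewrite ler_pM2r //; apply: mulr_gt0; [lia | apply: qpos].
    have : q * (q * q) <= q * (q * q ^+ m.-2).
      by rewrite -[q in q * (q * q)]expr1 -!exprS; apply: powle; lia.
    have := q3 1%N; have := mulr_gt0 (_ : 0 < q) (_ : 0 < q * q); rewrite expr1.
    lia.
  have q1 : 0 < q + 1 by lia.
  rewrite -(ltr_pM2l q1); move: bnd; rewrite m3 !exprS expr0 mulr1.
  have := q3 2%N; rewrite !exprS expr0 mulr1.
  have := q3 1%N; rewrite expr1.
  lia.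
split=> [|m3]; last by lia.
have t_ne : (q + 1) * t != q ^+ d + 1.
  apply: contraNneq ne => eqt.
  by rewrite mulrCA eqt eM.
have M_lt : q ^+ d + 1 < (q + 1) * t.
  by rewrite lt_neqAle eq_sym t_ne /=; apply: orbit_le_fixed_point ot => //; lia.
have := odd_period_orbit_max _ _ _ q_ge3 d_odd M_lt ot.
have [a Ea] := expr_mod_succ q d; rewrite d_odd expr1 in Ea.
have {}Ea : q ^+ d + 1 = (q + 1) * a by rewrite Ea; ring.
have q1 : 0 < q + 1 by lia.
have -> : q ^+ 2 * (q + 1) * t = (q + 1) * (q ^+ 2 * t) by ring.
rewrite {1}Ea mulrCA ler_pM2l // => le_a.
(* Equality would make q divide a, hence also 1 = (q + 1) a - q^d. *)
have ne_a : q ^+ 2 * t != (q ^+ 2 + q - 1) * a.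
  apply/eqP => eq_a.
  have a_eq : a = q * ((q + 1) * a - q * t) by rewrite expr2 in eq_a; lia.
  have qd : q ^+ d = q * q ^+ d.-1 by rewrite -exprS prednK; lia.
  have : 1 = q * ((q + 1) * ((q + 1) * a - q * t) - q ^+ d.-1).
    transitivity ((q ^+ d + 1) - q ^+ d); first by ring.
    by rewrite Ea {1}a_eq {1}qd; ring.
  move: (_ - q ^+ d.-1) => x qx1.
  have [x_le0|x_gt0] := lerP x 0.
    have : 0 <= q * - x by apply: mulr_ge0; lia.
    lia.
  have : q * 1 <= q * x by rewrite ler_pM2l; lia.
  lia.
have {ne_a le_a} le_a : (q ^+ 2 + q - 1) * a + 1 <= q ^+ 2 * t by lia.
have e_ge : q ^+ 4 <= e.
  rewrite leNgt; apply/negP => e_lt.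
  have : e * (q ^+ d + 1) <= q ^+ 4 * (q ^+ d + 1) by rewrite ler_pM2r // ltW.
  rewrite eM mulrDr mulr1 -exprD => le_m.
  have := powle (4 + d).+1 m; rewrite exprS.
  have := powle 4%N (4 + d)%N; have := q3 (4 + d)%N; have := qpos (4 + d)%N.
  lia.
have q2 : 0 < q ^+ 2 by apply: qpos.
rewrite -(ltr_pM2l q2) eM.
have le_a' : e * (q + 1) * ((q ^+ 2 + q - 1) * a + 1) <= e * (q + 1) * (q ^+ 2 * t).
  by rewrite ler_pM2l //; apply: mulr_gt0.
have eA : e * (q + 1) * ((q ^+ 2 + q - 1) * a + 1) = (q ^+ 2 + q - 1) * (q ^+ m + 1) + (q + 1) * e.
  by rewrite -eM Ea; ring.
have qm2 : q ^+ 2 * q ^+ m.-2 = q ^+ m by rewrite -exprD; congr (_ ^+ _); lia.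
have : (q + 1) * q ^+ 4 <= (q + 1) * e by rewrite ler_pM2l.
have -> : q ^+ 2 * (q ^+ m + 1 + (q - 1) * (q ^+ m.-2 + q ^+ 2)) =
  (q ^+ 2 + q - 1) * (q ^+ m + 1) + (q - 1) * (q ^+ 4 - 1).
  transitivity (q ^+ 2 * (q ^+ m + 1) + (q - 1) * (q ^+ 2 * q ^+ m.-2 + q ^+ 4)); first by ring.
  by rewrite qm2; ring.
have -> : q ^+ 2 * ((q + 1) * (e * t)) = e * (q + 1) * (q ^+ 2 * t) by ring.
have := qpos 4%N.
rewrite eA in le_a'; lia.
Qed.

(** * Coset leaders and orbits *)

(** The quotient is the alternating sum q^(d(h-1)) - ... - q^d + 1; it has h terms, all odd, and h
    is odd. *)
Lemma odd_expn_succ_quotient (q d h : nat) :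
  odd q -> odd h -> exists e, odd e /\ (e * (q ^ d + 1) = q ^ (d * h) + 1)%N.
Proof.
move=> q_odd h_odd; have -> : h = h./2.*2.+1 by rewrite -{1}(odd_double_half h) h_odd.
elim: h./2 => [|r [e [e_odd IH]]]; first by exists 1%N; rewrite muln1 mul1n.
have x_odd : odd (q ^ d) by rewrite oddX q_odd orbT.
have -> : (q ^ (d * r.+1.*2.+1) = q ^ d * (q ^ d * q ^ (d * r.*2.+1)))%N.
  by rewrite -!expnD; congr (_ ^ _)%N; lia.
move: (q ^ (d * r.*2.+1))%N (q ^ d)%N x_odd IH => y x x_odd IH.
exists (x * (x * e - 1) + 1)%N; split.
  have xe_odd : odd (x * e) by rewrite oddM x_odd.
  by rewrite oddD oddM oddB ?xe_odd ?andbF //; case: (x * e)%N xe_odd.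
have : (0 < x * e)%N by have := odd_gt0 x_odd; have := odd_gt0 e_odd; nia.
case E : (x * e)%N => [|z] // _; rewrite subSS subn0; nia.
Qed.

Lemma expn_period_gcd (q N i a b : nat) :
  (0 < a)%N -> i * q ^ a = i %[mod N] -> i * q ^ b = i %[mod N] ->
  i * q ^ gcdn a b = i %[mod N].
Proof.
move=> a_gt0 Pa Pb.
have mul k c : i * q ^ k = i %[mod N] -> i * q ^ (k * c) = i %[mod N].
  move=> Pk; elim: c => [|c IH]; first by rewrite muln0 expn0 muln1.
  by rewrite mulnS addnC expnD mulnA -modnMml IH modnMml.
have [u v Eg _] := egcdnP b a_gt0.
have := mul a u Pa; rewrite (mulnC a) Eg addnC expnD mulnA => H.
by rewrite -H mulnAC (mulnC v) -[RHS]modnMml (mul b v Pb) modnMml.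
Qed.

Definition qcoset (q N i : nat) : {set 'I_N} :=
  [set r : 'I_N | [exists k : 'I_N, val r == ((i * q ^ k) %% N)%N]].

Section Leaders.
Variables (q m : nat).
Hypotheses (q_odd : odd q) (q_gt1 : (1 < q)%N) (m_gt0 : (0 < m)%N).
Local Notation N := (q ^ m + 1)%N.
Local Notation n := (N %/ 2)%N.

Lemma double_half_N : N = n.*2.
Proof. by rewrite -muln2 divnK // dvdn2 oddD oddX q_odd orbT. Qed.

Lemma expn_period (k : nat) : q ^ k = q ^ (k %% m.*2) %[mod N].
Proof.
have per : q ^ m.*2 = 1 %[mod N].
  have -> : (q ^ m.*2 = N * (q ^ m).-1 + 1)%N.
    have : (0 < q ^ m)%N by rewrite expn_gt0 ltnW.
    rewrite -addnn expnD; nia.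
  by rewrite -modnDml modnMr add0n.
rewrite {1}(divn_eq k m.*2) expnD mulnC mulnC.
by rewrite (mulnC _ m.*2) expnM -modnMml -modnXm per modnXm exp1n modnMml mul1n.
Qed.

(** Powers of q have period 2m modulo N, so the exponents below N that occur in [coset_leader] and
    [qcoset] cover a full period. *)
Lemma double_m_le : (m.*2 <= N)%N.
Proof.
have : (m < 2 ^ m)%N by apply: ltn_expl.
have : (3 ^ m <= q ^ m)%N by rewrite leq_exp2r //; lia.
have : (m.*2 <= 3 ^ m)%N.
  elim: m => // k IH; rewrite expnS; have : (0 < 3 ^ k)%N by rewrite expn_gt0.
  by lia.
lia.
Qed.

Lemma coset_leaderP (i : nat) :
  reflect ((i < N)%N /\ forall k, (i <= (i * q ^ k) %% N)%N) (coset_leader q N i).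
Proof.
apply: (iffP andP) => [[i_lt /forallP le_i]|[i_lt le_i]]; split=> //; last first.
  by apply/forallP=> k; apply: le_i.
move=> k; rewrite -modnMmr expn_period modnMmr.
have k_lt : (k %% m.*2 < N)%N.
  by apply: leq_trans double_m_le; rewrite ltn_mod; lia.
exact: (le_i (Ordinal k_lt)).
Qed.

Lemma half_mul_expn (k : nat) : exists c, (n * q ^ k = n + N * c)%N.
Proof.
exists (q ^ k)./2; have N2 := double_half_N.
have qk_odd : odd (q ^ k) by rewrite oddX q_odd orbT.
have := odd_double_half (q ^ k); rewrite qk_odd.
move: (q ^ k)./2 => c <-; rewrite -muln2 in N2.
by rewrite {3}N2 mulnDr muln1 -muln2 (mulnC c) mulnA.
Qed.

Lemma int_N : N%:Z = q%:Z ^+ m + 1.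
Proof. by rewrite PoszD -[q%:Z]natz -natrX natz. Qed.

Lemma half_sub_residue (i k : nat) :
  exists s : int, (n%:Z - i%:Z) * q%:Z ^+ k - (q%:Z ^+ m + 1) * s =
    n%:Z - ((i * q ^ k) %% N)%N%:Z.
Proof.
have [c Ec] := half_mul_expn k.
have Ei := divn_eq (i * q ^ k) N.
exists (c%:Z - ((i * q ^ k) %/ N)%N%:Z); rewrite -int_N.
have -> : q%:Z ^+ k = (q ^ k)%N%:Z by rewrite -[q%:Z]natz -natrX natz.
move: (i * q ^ k %/ N)%N (i * q ^ k %% N)%N Ei => Q r Ei.
rewrite mulrBl -!PoszM Ec Ei !PoszD !PoszM; ring.
Qed.

Lemma residue_opp (i k : nat) :
  ((i * q ^ k) %% N + (i * q ^ (k + m)) %% N = 0 %[mod N])%N.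
Proof.
have -> : (i * q ^ (k + m) = i * q ^ k * q ^ m)%N by rewrite expnD mulnA.
by rewrite modnDm -{1}[(i * q ^ k)%N]muln1 -mulnDr addnC modnMl mod0n.
Qed.

(** The coset is closed under negation, so a residue r in it satisfies both i <= r and i <= N - r,
    that is |n - r| <= n - i. Positivity of i keeps the residues nonzero, so that opposite ones add
    up to exactly N. *)
Lemma coset_leader_orbit_le (i : nat) :
  (0 < i)%N -> coset_leader q N i ->
  (i <= n)%N /\ orbit_le q%:Z (q%:Z ^+ m + 1) (n%:Z - i%:Z) (n%:Z - i%:Z).
Proof.
move=> i_gt0 /coset_leaderP [i_lt le_i].
have bnd k : (i <= (i * q ^ k) %% N <= N - i)%N.
  rewrite le_i /=; have := residue_opp i k; have := le_i (k + m)%N; have := le_i k.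
  have : ((i * q ^ k) %% N < N)%N by rewrite ltn_mod; lia.
  have : ((i * q ^ (k + m)) %% N < N)%N by rewrite ltn_mod; lia.
  move: ((i * q ^ k) %% N)%N ((i * q ^ (k + m)) %% N)%N => a b b_lt a_lt ia ib.
  rewrite mod0n => /eqP /dvdnP [c abc].
  have c_gt0 : (0 < c)%N by case: c abc; lia.
  have : (N <= c * N)%N by rewrite leq_pmull.
  have : c = 1%N by nia.
  lia.
have i_le : (i <= n)%N.
  have := bnd 0%N; rewrite expn0 muln1 modn_small //; have := double_half_N; lia.
split=> // k; have [s Es] := half_sub_residue i k; exists s; rewrite Es.
have := bnd k; have := double_half_N.
move: ((i * q ^ k) %% N)%N => r; lia.
Qed.

Lemma orbit_le_coset_leader (j : nat) :
  (j < n)%N -> orbit_le q%:Z (q%:Z ^+ m + 1) j%:Z j%:Z -> coset_leader q N (n - j).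
Proof.
move=> j_lt oj; apply/coset_leaderP; have N2 := double_half_N.
split=> [|k]; first by lia.
have [s Es] := half_sub_residue (n - j) k; have [s' Hs'] := oj k.
have jE : n%:Z - (n - j)%N%:Z = j%:Z by lia.
rewrite {}jE in Es.
have : (((n - j) * q ^ k) %% N < N)%N by rewrite ltn_mod; lia.
move: (((n - j) * q ^ k) %% N)%N Es => r Es r_lt.
have eqd : j%:Z * q%:Z ^+ k - (q%:Z ^+ m + 1) * s' = n%:Z - r%:Z + N%:Z * (s - s').
  by rewrite -Es -int_N; ring.
rewrite eqd in Hs'.
(* Any representative other than n - r has absolute value at least n, which exceeds j; hence s =
   s'. *)
have [v_le0|v_gt0] := lerP (s - s') 0; last first.
  have : 0 <= N%:Z * (s - s' - 1) by apply: mulr_ge0; lia.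
  lia.
have [v0|v_ne0] := eqVneq (s - s') 0; first by rewrite v0 in Hs'; lia.
have : 0 <= N%:Z * (- (s - s') - 1) by apply: mulr_ge0; lia.
lia.
Qed.

Lemma qcosetP (i : nat) (r : 'I_N) :
  reflect (exists k, r = ((i * q ^ k) %% N)%N :> nat) (r \in qcoset q N i).
Proof.
rewrite inE; apply: (iffP existsP) => [[k /eqP]|[k Ek]]; first by exists k.
have k_lt : (k %% m.*2 < N)%N.
  by apply: leq_trans double_m_le; rewrite ltn_mod; lia.
by exists (Ordinal k_lt); apply/eqP; rewrite /= [LHS]Ek -modnMmr expn_period modnMmr.
Qed.

Lemma coprime_q_N : coprime q N.
Proof.
by rewrite /coprime -(prednK m_gt0) expnS mulnC gcdnMDl gcdn1.
Qed.

Lemma card_qcoset (i : nat) :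
  (forall s, (0 < s < m.*2)%N -> i * q ^ s <> i %[mod N]) ->
  #|qcoset q N i| = m.*2.
Proof.
move=> no_per; have N_gt0 : (0 < N)%N by lia.
pose f (k : 'I_(m.*2)) : 'I_N := Ordinal (ltn_pmod (i * q ^ k) N_gt0).
have -> : qcoset q N i = f @: [set: 'I_(m.*2)].
  apply/setP=> r; apply/qcosetP/imsetP => [[k Ek]|[k _ ->]]; last by exists k.
  have k_lt : (k %% m.*2 < m.*2)%N by rewrite ltn_mod; lia.
  exists (Ordinal k_lt); rewrite ?inE //; apply: val_inj.
  by rewrite /= Ek -modnMmr expn_period modnMmr.
rewrite card_imset ?cardsT ?card_ord // => a b /(congr1 val) /= eqab.
wlog le_ab : a b eqab / (a <= b)%N.
  by move=> W; have [/W->|/ltnW/W->] := leqP a b.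
have [/val_inj //|ne_ab] := eqVneq (a : nat) b.
case: (no_per (b - a)%N); first by have := ltn_ord b; lia.
move/eqP: eqab; rewrite eq_sym -{1}(subnKC le_ab) addnC expnD mulnA.
rewrite eqn_mod_dvd ?leq_mul // ?leq_pmulr ?expn_gt0 ?(ltnW q_gt1) //.
rewrite -mulnBl Gauss_dvdl; last by rewrite coprime_sym coprimeXl // coprime_q_N.
by rewrite -eqn_mod_dvd ?leq_pmulr ?expn_gt0 ?(ltnW q_gt1) // => /eqP.
Qed.

(* The exponents fixing i form a subgroup generated by some g dividing 2m. If g divides m,
   then i = -i; otherwise g = 2d with m/d odd, and i q^d = i q^m = -i. *)
Lemma short_coset_quotient (i s : nat) :
  (i < n)%N -> ~~ (n %| i)%N -> (0 < s < m.*2)%N -> i * q ^ s = i %[mod N] ->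
  exists d e t : nat, [/\ (0 < d)%N, (d * 3 <= m)%N, (odd m -> odd d) &
    [/\ odd e, (e * (q ^ d + 1) = N)%N & (n - i = e * t)%N]].
Proof.
move=> i_lt n_i /andP[s_gt0 s_lt] Ps.
have N2 := double_half_N.
have P2m : i * q ^ m.*2 = i %[mod N].
  by rewrite -modnMmr expn_period modnn expn0 modnMmr muln1.
have := expn_period_gcd _ _ _ _ _ s_gt0 Ps P2m.
have g_le : (gcdn s m.*2 <= s)%N by apply: dvdn_leq; rewrite ?dvdn_gcdl.
have g_gt0 : (0 < gcdn s m.*2)%N by rewrite gcdn_gt0 s_gt0.
have g_dvd : (gcdn s m.*2 %| m.*2)%N by apply: dvdn_gcdr.
move: (gcdn _ _) g_le g_gt0 g_dvd => g g_le g_gt0 /dvdnP[h Eh] Pg.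
have opp : (N %| i * q ^ m + i)%N.
  by rewrite -{2}[i]muln1 -mulnDr dvdn_mull.
have mulP c : i * q ^ (g * c) = i %[mod N].
  elim: c => [|c IH]; first by rewrite muln0 expn0 muln1.
  by rewrite mulnS addnC expnD mulnA -modnMml IH modnMml.
have h_odd : odd h.
  apply/negP => /negP h_even; case/negP: n_i.
  have Em : (m = g * h./2)%N.
    by move: Eh; rewrite -{1}(odd_double_half h) (negbTE h_even) add0n; lia.
  have := mulP h./2; rewrite -Em => Pm.
  have : (N %| i + i)%N by rewrite /dvdn -modnDml -Pm modnDml.
  by rewrite addnn -!muln2 {1}N2 -muln2 dvdn_pmul2r.
have g_even : ~~ odd g.
  by have := odd_double m; rewrite Eh oddM h_odd /= => ->.
have Eg : (g = g./2.*2)%N by rewrite -{1}(odd_double_half g) (negbTE g_even).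
move: (g./2) Eg => d Eg.
have Em : (m = d * h)%N by apply: double_inj; rewrite Eh Eg doubleMl mulnC.
have h_ge3 : (3 <= h)%N by clear -h_odd Eh g_le s_lt; case: h h_odd Eh => [|[|[]]] //; lia.
have [e [e_odd Ee]] := odd_expn_succ_quotient q d h q_odd h_odd.
rewrite -Em in Ee.
have e_gt0 := odd_gt0 e_odd.
have opp_d : (N %| i * (q ^ d + 1))%N.
  rewrite mulnDr muln1 /dvdn -modnDml.
  have Eqm : (q ^ m = q ^ (g * h./2) * q ^ d)%N.
    rewrite -expnD Em Eg -{1}(odd_double_half h) h_odd mulnDr muln1.
    by rewrite -doubleMl -doubleMr addnC.
  have Pd Q : (Q = q ^ (g * h./2) * q ^ d)%N -> i * q ^ d = i * Q %[mod N].
    by move->; rewrite mulnA -[RHS]modnMml mulP modnMml.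
  by rewrite (Pd _ Eqm) modnDml.
(* Cancelling q^d + 1 from N = e (q^d + 1) shows that e divides i. It also divides n = N / 2,
   because q^d + 1 is even, and so it divides n - i. *)
have e_i : (e %| i)%N by move: opp_d; rewrite -Ee dvdn_pmul2r //; lia.
have e_n : (e %| n)%N.
  have qd_odd : odd (q ^ d) by rewrite oddX q_odd orbT.
  have := odd_double_half (q ^ d); rewrite qd_odd; move: (q ^ d)./2 => x Ex.
  have : (e * x.+1.*2 = n.*2)%N.
    by rewrite -N2 -Ee -Ex; congr (_ * _)%N; rewrite doubleS addn1 add1n.
  by rewrite -!muln2 mulnA => /eqP; rewrite eqn_pmul2r // => /eqP <-; apply: dvdn_mulr.
have /dvdnP[t Et] : (e %| n - i)%N by rewrite dvdn_subr // ltnW.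
have d_gt0 : (0 < d)%N by rewrite -double_gt0 -Eg.
exists d, e, t; split; [exact: d_gt0 | | | split; [exact: e_odd | exact: Ee | by rewrite Et mulnC]].
  by rewrite Em leq_mul2l h_ge3 orbT.
by rewrite Em oddM => /andP[].
Qed.

End Leaders.

(** * The decreasing list of odd coset leaders *)

Lemma mem_odd_coset_leaders (q N i : nat) :
  (i \in odd_coset_leaders q N) = odd i && coset_leader q N i.
Proof.
rewrite mem_filter mem_iota add0n /=.
by case: (odd i) => //=; rewrite /coset_leader; case: (i < N)%N => //=; rewrite andbT.
Qed.

Lemma rev_odd_coset_leaders_sorted (q N : nat) :
  sorted gtn (rev (odd_coset_leaders q N)).
Proof.
rewrite rev_sorted /odd_coset_leaders.
by apply: sorted_filter; [exact: ltn_trans | exact: iota_ltn_sorted].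
Qed.

Lemma delta_ltn (q N j k : nat) :
  (0 < j < k)%N -> (k <= size (odd_coset_leaders q N))%N -> (delta q N k < delta q N j)%N.
Proof.
move=> /andP[j_gt0 jk] k_le.
have := rev_odd_coset_leaders_sorted q N.
move/(sorted_ltn_nth (fun a b c ba ac => ltn_trans ac ba : gtn b c) 0%N) => /(_ j.-1 k.-1).
rewrite !inE !size_rev; apply; lia.
Qed.

Lemma delta_index (q N i : nat) :
  odd i && coset_leader q N i ->
  exists j, (0 < j <= size (odd_coset_leaders q N))%N /\ delta q N j = i.
Proof.
rewrite -mem_odd_coset_leaders -mem_rev => i_in.
exists (index i (rev (odd_coset_leaders q N))).+1; split.
  by rewrite /= -size_rev index_mem.
exact: nth_index.
Qed.

Lemma delta_odd_leader (q N j : nat) :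
  (0 < j <= size (odd_coset_leaders q N))%N ->
  odd (delta q N j) && coset_leader q N (delta q N j).
Proof.
move=> j_le; rewrite -mem_odd_coset_leaders -mem_rev; apply: mem_nth.
by rewrite size_rev; case: j j_le.
Qed.

(** Controls the second and third leaders without computing them: any known odd leader below one
    entry of the list confines the next entry. *)
Lemma delta_next (q N i j : nat) :
  (0 < j)%N -> odd i && coset_leader q N i -> (i < delta q N j)%N ->
  [/\ odd (delta q N j.+1) && coset_leader q N (delta q N j.+1),
      (i <= delta q N j.+1)%N & (delta q N j.+1 < delta q N j)%N].
Proof.
move=> j_gt0 /delta_index [k [/andP[k_gt0 k_le] <-]] ltd.
have j_lt : (j < k)%N.
  rewrite ltnNge; apply/negP; rewrite leq_eqVlt => /predU1P[eqk|kj].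
    by rewrite eqk ltnn in ltd.
  (* Past the end of the list [delta] takes the default value 0, which cannot lie above a leader. *)
  have [j_le|j_gt] := leqP j (size (odd_coset_leaders q N)).
    by have := @delta_ltn q N k j; rewrite kj k_gt0 j_le => /(_ isT isT); lia.
  by move: ltd; rewrite {2}/delta nth_default // size_rev; lia.
have j1_le : (j.+1 <= size (odd_coset_leaders q N))%N by exact: leq_trans k_le.
split; first by apply: delta_odd_leader; rewrite j1_le.
  have [->//|ne] := eqVneq j.+1 k.
  by apply: ltnW; apply: delta_ltn; [rewrite /= ltn_neqAle ne |].
by apply: delta_ltn; rewrite ?j_gt0 /=.
Qed.

Lemma delta_above (q N i j : nat) :
  (0 < j)%N -> odd i && coset_leader q N i -> (delta q N j <= i)%N ->
  exists k, (0 < k <= j)%N /\ i = delta q N k.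
Proof.
move=> j_gt0 /delta_index [k [/andP[k_gt0 k_le] <-]] led.
exists k; split=> //; rewrite k_gt0 leqNgt; apply/negP => jk.
by have := @delta_ltn q N j k; rewrite j_gt0 jk => /(_ isT k_le); lia.
Qed.

Lemma delta1_max (q N i : nat) :
  odd i && coset_leader q N i ->
  (forall k, odd k && coset_leader q N k -> (k <= i)%N) -> delta q N 1 = i.
Proof.
move=> /delta_index [k [/andP[k_gt0 k_le] <-]] maxk.
have [->//|ne] := eqVneq 1%N k.
have d1 : odd (delta q N 1) && coset_leader q N (delta q N 1).
  by apply: delta_odd_leader; lia.
have := @delta_ltn q N 1 k; have := maxk _ d1; lia.
Qed.

(** * Cosets of the three largest odd leaders *)

Section TopLeaders.
Variables (q m : nat).
Hypotheses (q_odd : odd q) (q_gt1 : (1 < q)%N) (m_gt1 : (1 < m)%N).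
Local Notation N := (q ^ m + 1)%N.
Local Notation n := (N %/ 2)%N.
Local Notation odd_leader i := (odd i && coset_leader q N i).

Let m_gt0 : (0 < m)%N. Proof. exact: ltnW. Qed.
Let q_ge3 : 3 <= q%:Z. Proof. by case: q q_odd q_gt1 => [|[|[|]]]. Qed.
Let q_oddZ : exists u : int, q%:Z = 2 * u + 1.
Proof. by exists (q./2)%:Z; have := odd_double_half q; rewrite q_odd; lia. Qed.

Lemma intX (k : nat) : (q ^ k)%N%:Z = q%:Z ^+ k.
Proof. by rewrite -[q%:Z]natz -natrX natz. Qed.

Lemma full_coset (i : nat) :
  (i < n)%N -> odd_leader i ->
  (forall d e t : nat, (0 < d)%N -> (d * 3 <= m)%N -> (odd m -> odd d) -> odd e ->
     e%:Z * (q%:Z ^+ d + 1) = q%:Z ^+ m + 1 -> (n - i)%N = (e * t)%N -> (0 < t)%N ->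
     orbit_le q%:Z (q%:Z ^+ m + 1) (e%:Z * t%:Z) (e%:Z * t%:Z) -> False) ->
  #|qcoset q N i| = m.*2.
Proof.
move=> i_lt /andP[i_odd i_lead] no_short.
have i_gt0 := odd_gt0 i_odd.
apply: card_qcoset => // s s_bnd Ps.
have n_i : ~~ (n %| i)%N by apply/negP => /dvdn_leq; move/(_ i_gt0); rewrite leqNgt i_lt.
have [d [e [t [d_gt0 d_le d_odd [e_odd Ee Et]]]]] :=
  short_coset_quotient q m q_odd q_gt1 m_gt0 i s i_lt n_i s_bnd Ps.
have t_gt0 : (0 < t)%N.
  by case: (t) Et => //; rewrite muln0 => /eqP; rewrite subn_eq0 leqNgt i_lt.
have [_ oi] := coset_leader_orbit_le q m q_odd q_gt1 m_gt0 i i_gt0 i_lead.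
apply: (no_short d e t) => //; first by rewrite -(int_N q m) -Ee PoszM PoszD intX.
by rewrite -PoszM -Et -subzn // ltnW.
Qed.

(** As n and i are odd while e is odd, t is even; a short coset would then lie strictly below the
    range of i allowed here. *)
Lemma full_coset_even (i : nat) :
  odd n -> (i < n)%N -> odd_leader i -> (n - (q ^ m.-1 + q) <= i)%N ->
  #|qcoset q N i| = m.*2.
Proof.
move=> n_odd i_lt lead i_ge; apply: full_coset => // d e t d_gt0 d_le _ e_odd Ee Et t_gt0 ot.
have i_odd : odd i by case/andP: lead.
have t_even : exists u : int, t%:Z = 2 * u.
  have : ~~ odd (n - i)%N by rewrite oddB ?(ltnW i_lt) // n_odd i_odd.
  rewrite Et oddM e_odd /= => t_even.
  exists (t./2)%:Z; have := odd_double_half t; rewrite (negbTE t_even); clear; lia.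
have e_gt0 : 0 < e%:Z by have := odd_gt0 e_odd.
have := orbit_max_short_even _ _ t%:Z m d q_ge3 q_oddZ d_gt0 d_le e_gt0 Ee t_gt0 t_even ot.
rewrite -intX -PoszM -PoszD -Et.
move: i_ge i_lt; clear; move: (q ^ m.-1)%N (q ^ m + 1)%N => x y.
lia.
Qed.

(** Now n - i, and with it t, is odd. The inequation excludes the first leader, whose coset is
    short. The two alternatives are the two forms of the lower bound on short orbits: the general
    one, and the one fitted to the special third witness for m = 3. *)
Lemma full_coset_odd (i j : nat) :
  ~~ odd n -> odd m -> (i < n)%N -> odd_leader i -> (n - j <= i)%N ->
  ((q + 1) * (n - i))%N != N ->
  ((q + 1) * j <= N + (q - 1) * (q ^ m.-2 + q ^ 2))%N \/
  m = 3%N /\ (j <= q ^ 2 + q + 1)%N ->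
  #|qcoset q N i| = m.*2.
Proof.
move=> n_even m_odd i_lt lead i_ge i_ne bnd.
apply: full_coset => // d e t d_gt0 d_le d_odd e_odd Ee Et t_gt0 ot.
have i_odd : odd i by case/andP: lead.
have t_odd : exists u : int, t%:Z = 2 * u + 1.
  have : odd (n - i)%N by rewrite oddB ?(ltnW i_lt) // (negbTE n_even) i_odd.
  rewrite Et oddM e_odd /= => t_odd.
  exists (t./2)%:Z; have := odd_double_half t; rewrite t_odd; clear; lia.
have e_gt0 : 0 < e%:Z by have := odd_gt0 e_odd.
have ne : (q%:Z + 1) * (e%:Z * t%:Z) != q%:Z ^+ m + 1.
  rewrite -(int_N q m) -PoszM -Et.
  by apply: contra i_ne => /eqP; rewrite -[1]/1%:Z -PoszD -PoszM => -[->].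
have [big1 big2] := orbit_max_short_odd _ _ t%:Z m d q_ge3 (d_odd m_odd) m_odd d_le e_gt0 Ee t_gt0 t_odd ne ot.
have le_j : (n - i <= j)%N by move: i_ge i_lt; clear; move: (_ %/ _)%N => y; lia.
case: bnd => [bnd|[m3 bnd]].
  move: big1; rewrite -(int_N q m) -!intX -PoszM -Et.
  have : ((q + 1) * (n - i) <= (q + 1) * j)%N by rewrite leq_mul2l le_j orbT.
  move: bnd; clear -q_gt1; move: (q ^ m.-2)%N (q ^ 2)%N (n - i)%N (q ^ m + 1)%N => a b c y.
  have -> : q%:Z - 1 = (q - 1)%N%:Z by lia.
  lia.
move: (big2 m3); rewrite -!intX -PoszM -Et; move: bnd le_j; clear.
by move: (q ^ 2)%N (n - i)%N => a c; lia.
Qed.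

End TopLeaders.

Section TopCosets.
Variables (q m : nat).
Hypotheses (q_odd : odd q) (q_gt1 : (1 < q)%N) (m_gt1 : (1 < m)%N).
Local Notation N := (q ^ m + 1)%N.
Local Notation n := (N %/ 2)%N.
Local Notation odd_leader i := (odd i && coset_leader q N i).

Let m_gt0 : (0 < m)%N. Proof. exact: ltnW. Qed.
Let q_gt2 : (2 < q)%N. Proof. by case: q q_odd q_gt1 => [|[|[|]]]. Qed.
Let q_ge3 : 3 <= q%:Z. Proof. exact: q_gt2. Qed.

Definition top_cosets (kappa : nat) : Prop :=
  [/\ odd_leader (delta q N 1), #|qcoset q N (delta q N 1)| = kappa,
   [/\ odd_leader (delta q N 2), (delta q N 2 < delta q N 1)%N
     & #|qcoset q N (delta q N 2)| = m.*2]
 & (25 <= q ^ m)%N ->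
   [/\ odd_leader (delta q N 3), (delta q N 3 < delta q N 2)%N
     & #|qcoset q N (delta q N 3)| = m.*2]].

(** Only [i1] is identified with an entry of the list. Since [i2] and [i3] are mere lower bounds for
    the next two, full cosets are required on the whole range from [i3] up to [i1]. For small q^m,
    [i3] need not be a leader, but it still bounds the second entry. *)
Lemma top_cosetsI (kappa i1 i2 i3 : nat) :
  odd_leader i1 -> (forall i, odd_leader i -> (i <= i1)%N) ->
  #|qcoset q N i1| = kappa -> odd_leader i2 -> (i3 < i2 < i1)%N ->
  ((25 <= q ^ m)%N -> odd_leader i3) ->
  (forall i, odd_leader i -> (i3 <= i < i1)%N -> #|qcoset q N i| = m.*2) ->
  top_cosets kappa.
Proof.
move=> lead1 max1 card1 lead2 /andP[i32 i21] lead3 full.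
have d1 := delta1_max q N i1 lead1 max1.
rewrite /top_cosets d1.
have := delta_next q N i2 1 isT lead2; rewrite d1 => /(_ i21) [lead_d2 i2_le d2_lt].
have i3_d2 : (i3 < delta q N 2)%N := leq_trans i32 i2_le.
split=> //; first by split=> //; apply: full; rewrite // d2_lt ltnW.
move=> /lead3 {}lead3.
have [lead_d3 i3_le d3_lt] := delta_next q N i3 2 isT lead3 i3_d2.
by split=> //; apply: full; rewrite // i3_le (ltn_trans d3_lt).
Qed.

Lemma odd_half_N : odd n = (q ^ m %% 4 == 1)%N.
Proof.
have : odd (q ^ m) by rewrite oddX q_odd orbT.
by clear; move: (q ^ m)%N => x; lia.
Qed.

(** For even m the power q^m is an odd square, hence 1 modulo 4. *)
Lemma even_half_odd_exponent : ~~ odd n -> odd m.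
Proof.
rewrite odd_half_N; apply: contraR => m_even.
have -> : m = (m./2 * 2)%N by rewrite muln2 -{1}(odd_double_half m) (negbTE m_even).
rewrite expnM; have : odd (q ^ m./2) by rewrite oddX q_odd orbT.
move: (q ^ m./2)%N => x x_odd.
have -> : (x ^ 2 = 4 * (x./2 * (x./2).+1) + 1)%N.
  by have := odd_double_half x; rewrite x_odd; move: (x./2) => y <-; rewrite /= -mul2n expnS expn1; lia.
by rewrite mulnC modnMDl.
Qed.

Lemma top_cosets_even_half : odd n -> top_cosets 1.
Proof.
move=> n_odd; have N2 := double_half_N q m q_odd.
have x_odd : odd (q ^ m.-1) by rewrite oddX q_odd orbT.
have qm : (q ^ m = q * q ^ m.-1)%N by rewrite -expnS prednK.
have q_le : (q <= q ^ m.-1)%N by rewrite -{1}(expn1 q) leq_exp2l //; case: m m_gt1 => [|[]].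
have bnd2 : (q ^ m.-1 + 1 < n)%N.
  move: N2 q_le; rewrite {1}qm; move: (n) (q ^ m.-1)%N q_gt2; clear => y x q2 N2 qx.
  have : (3 * x <= q * x)%N by rewrite leq_mul2r q2 orbT.
  lia.
(* The only excluded power is 9, where n = 5 but q^(m-1) + q = 6. There the third witness below
   truncates to 0, which is still less than the second. *)
have bnd3 : (25 <= q ^ m)%N -> (q ^ m.-1 + q < n)%N.
  move: N2 q_le; rewrite {1}qm {2}qm; move: (n) (q ^ m.-1)%N q_gt2; clear -q_odd => y x q2 N2 qx le25.
  have : (3 * x <= q * x)%N by rewrite leq_mul2r q2 orbT.
  have [q3|q5] : (q = 3 \/ 5 <= q)%N by lia.
    by rewrite q3 in le25 N2 *; lia.
  have : (5 * x <= q * x)%N by rewrite leq_mul2r q5 orbT.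
  lia.
have n_gt0 : (0 < n)%N by apply: leq_ltn_trans bnd2.
apply: (@top_cosetsI _ n (n - (q ^ m.-1 + 1)) (n - (q ^ m.-1 + q))).
- rewrite n_odd -[n]subn0; apply: orbit_le_coset_leader => // k.
  by exists 0; rewrite mul0r mulr0 subr0 normr0.
- move=> i /andP[/odd_gt0 i_gt0].
  by case/(coset_leader_orbit_le q m q_odd q_gt1 m_gt0 i i_gt0).
- have n_lt : (n < N)%N by rewrite {2}N2 -addnn -{1}[n]addn0 ltn_add2l.
  rewrite (_ : qcoset q N n = [set Ordinal n_lt]) ?cards1 //.
  apply/setP=> r; rewrite in_set1; apply/qcosetP/eqP => // [[k Ek]|->].
    apply: val_inj; rewrite /= [LHS]Ek.
    have [c ->] := half_mul_expn q m q_odd k.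
    by rewrite addnC mulnC modnMDl modn_small.
  by exists 0%N; rewrite /= expn0 muln1 modn_small.
- rewrite oddB ?(ltnW bnd2) // n_odd oddD x_odd /=.
  apply: orbit_le_coset_leader => //.
  by rewrite PoszD intX; apply: orbit_le_pow_succ.
- apply/andP; split; last by move: n_gt0 bnd2; clear; move: (n) (q ^ m.-1)%N => y x; lia.
  by move: n_gt0 bnd2 q_gt2; clear; move: (n) (q ^ m.-1)%N => y x; lia.
- move=> /bnd3 {}bnd3.
  rewrite oddB ?(ltnW bnd3) // n_odd oddD x_odd q_odd /=.
  apply: orbit_le_coset_leader => //.
  by rewrite PoszD intX; apply: orbit_le_pow_add.
- by move=> i lead /andP[i_ge i_lt]; apply: full_coset_even.
Qed.

Lemma top_cosets_odd_half : ~~ odd n -> top_cosets 2.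
Proof.
move=> n_even; have N2 := double_half_N q m q_odd.
have m_odd := even_half_odd_exponent n_even.
have [A [A_odd]] := odd_expn_succ_quotient q 1 m q_odd m_odd.
rewrite mul1n expn1 mulnC => EA.
have A_gt0 := odd_gt0 A_odd.
have A_lt : (A < n)%N.
  have : (3 * A < (q + 1) * A)%N by rewrite ltn_mul2r A_gt0; lia.
  rewrite EA; move: N2; move: (n) (N); clear; lia.
have EAz : q%:Z ^+ m + 1 = (q%:Z + 1) * A%:Z by rewrite -(int_N q m) -EA PoszM PoszD.
(* The alternating construction gives [T2] with w = 1 and, for m >= 5, [T3] with w = 2. Both have
   the form A + (q - 1) c with (q + 1) c = q^(m-2) + q^(2w-2), so they are odd like A. For w = 2 the
   value (q + 1) T3 is exactly the strict lower bound for short orbits. For m = 3 only w = 1 fits,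
   and q^2 + q + 1 replaces the missing value. *)
have [T2 [T3 [T2_odd T3_odd [T23 T3n] AT2 [o2 o3 bnd]]]] : exists T2 T3 : nat,
  [/\ odd T2, odd T3, (T2 < T3)%N /\ (T3 < n)%N, (A < T2)%N &
   [/\ orbit_le q%:Z (q%:Z ^+ m + 1) T2%:Z T2%:Z,
       orbit_le q%:Z (q%:Z ^+ m + 1) T3%:Z T3%:Z &
  ((q + 1) * T3 <= N + (q - 1) * (q ^ m.-2 + q ^ 2))%N \/
  m = 3%N /\ (T3 <= q ^ 2 + q + 1)%N]].
  have alt w c : (0 < w)%N -> (w.*2 < m)%N ->
      ((q + 1) * c = q ^ m.-2 + q ^ (w.*2).-2)%N ->
      orbit_le q%:Z (q%:Z ^+ m + 1) (A + (q - 1) * c)%N%:Z (A + (q - 1) * c)%N%:Z.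
    move=> w_gt0 w_lt Ec; apply: (@orbit_le_alternating _ _ m w) => //.
    have Ecz : q%:Z ^+ m.-2 + q%:Z ^+ (w.*2).-2 = (q%:Z + 1) * c%:Z.
      by rewrite -!intX -PoszD -Ec PoszM PoszD.
    by rewrite EAz Ecz PoszD PoszM -(subzn (ltnW q_gt1)); ring.
  have T_odd c : odd (A + (q - 1) * c) by rewrite oddD A_odd oddM oddB ?q_odd // ltnW.
  have q1_gt0 : (0 < q - 1)%N by rewrite subn_gt0.
  have m2_odd : odd m.-2 by case: m m_gt1 m_odd => [|[|k]] //= _; rewrite negbK.
  have [c2 [c2_odd]] := odd_expn_succ_quotient q 1 m.-2 q_odd m2_odd.
  rewrite mul1n expn1 mulnC => Ec2.
  have m_ge3 : (2 < m)%N by rewrite ltn_neqAle m_gt1 andbT; apply: contraTneq m_odd => <-.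
  have o2 := alt 1%N c2 isT m_ge3 Ec2.
  have [m3|m_ne3] := eqVneq m 3%N.
    exists (A + (q - 1) * c2)%N, (q ^ 2 + q + 1)%N.
    have c2_1 : c2 = 1%N.
      by move: Ec2; rewrite m3 expn1 -{2}[(q + 1)%N]muln1 => /eqP; rewrite eqn_pmul2l ?addn1 // => /eqP.
    have Nq : (N = q * (q * q) + 1)%N by rewrite m3 !expnS expn0 muln1.
    have q3 : (3 * q <= q * q)%N by rewrite leq_mul2r q_gt2 orbT.
    have q33 : (3 * (q * q) <= q * (q * q))%N by rewrite leq_mul2r q_gt2 orbT.
    have q2m1 : ((q - 1) * (q + 1) + 1 = q * q)%N 
      by clear -q_gt1; case: (q) q_gt1 => // k _; rewrite subn1 /=; lia.
    split=> //; last 1 first.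
    - split=> //; last by right.
      rewrite m3 !PoszD intX; exact: orbit_le_geom3.
    - by rewrite !oddD oddX q_odd.
    - split.
        have q1 : (0 < q + 1)%N by rewrite addn1.
        rewrite -(ltn_pmul2l q1) mulnDr EA c2_1 muln1 Nq expnS expn1 (mulnC (q + 1)%N (q - 1)%N).
        by move: q2m1 q3; clear; move: ((q - 1) * (q + 1))%N => y; lia.
      move: N2; rewrite Nq expnS expn1; move: (n) q3 q33 q_gt2; clear => y; lia.
    - by rewrite -[X in (X < _)%N]addn0 ltn_add2l muln_gt0 q1_gt0 odd_gt0.
  have m4_odd : odd m.-2.-2.
    by case: m m_ge3 m_ne3 m_odd => [|[|[|[|k]]]] //= _ _; rewrite !negbK.
  have m_ge5 : (4 < m)%N.
    by case: m m_ge3 m_ne3 m_odd => [|[|[|[|[|k]]]]].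
  have [c3 [c3_odd]] := odd_expn_succ_quotient q 1 m.-2.-2 q_odd m4_odd.
  rewrite mul1n expn1 mulnC => Ec3.
  have Ec4 : ((q + 1) * (q ^ 2 * c3) = q ^ m.-2 + q ^ 2)%N.
    rewrite mulnCA Ec3 mulnDr muln1 -expnD; congr (q ^ _ + _)%N.
    by case: m m_ge5 => [|[|[|[|k]]]].
  have o3 := alt 2%N _ isT m_ge5 Ec4.
  exists (A + (q - 1) * c2)%N, (A + (q - 1) * (q ^ 2 * c3))%N.
  have q1 : (0 < q + 1)%N by rewrite addn1.
  have q2_gt1 : (1 < q ^ 2)%N by rewrite -{1}(expn0 q) ltn_exp2l.
  have ET3 : ((q + 1) * (A + (q - 1) * (q ^ 2 * c3)) = N + (q - 1) * (q ^ m.-2 + q ^ 2))%N.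
    by rewrite mulnDr EA mulnCA Ec4.
  split=> //; last by split=> //; left; rewrite ET3.
    split.
      rewrite ltn_add2l ltn_pmul2l // -(ltn_pmul2l q1) Ec2 Ec4.
      by rewrite ltn_add2l.
    rewrite -(ltn_pmul2l q1) ET3.
    have qx : (q ^ 2 <= q ^ m.-2)%N by rewrite leq_exp2l //; case: m m_ge5 => [|[|[|[|]]]].
    have Nx : (N = q ^ 2 * q ^ m.-2 + 1)%N by rewrite -expnD; case: m m_gt1 => [|[|]].
    have q2x : (9 * q ^ m.-2 <= q ^ 2 * q ^ m.-2)%N.
      by rewrite leq_mul2r (_ : 9 = 3 ^ 2)%N // leq_exp2r // q_gt2 orbT.
    have x_gt0 : (0 < q ^ m.-2)%N by rewrite expn_gt0 ltnW.
    have lt : ((q - 1) * (2 * (q ^ m.-2 + q ^ 2)) < (q - 1) * N)%N.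
      rewrite ltn_pmul2l // Nx; move: qx q2x x_gt0; clear.
      by move: (q ^ m.-2)%N (q ^ 2)%N => x y; lia.
    have q1N : ((q + 1) * N = (q - 1) * N + 2 * N)%N.
      by rewrite -mulnDl; congr (_ * _)%N; move: q_gt1; clear; lia.
    move: lt q1N N2; clear; move: (N) (n) (q ^ m.-2 + q ^ 2)%N => x y z.
    move: (q - 1)%N (q + 1)%N => p s lt q1N N2; rewrite N2 -muln2 in q1N lt *.
    by lia.
  by rewrite -[X in (X < _)%N]addn0 ltn_add2l muln_gt0 q1_gt0 odd_gt0.
have i1_even : odd (n - A) by rewrite oddB ?(ltnW A_lt) // (negbTE n_even) A_odd.
apply: (@top_cosetsI _ (n - A) (n - T2) (n - T3)).
- rewrite i1_even; apply: orbit_le_coset_leader => // k.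
  have [c Ec] := expr_mod_succ q k; exists c.
  have -> : A%:Z * q%:Z ^+ k - (q%:Z ^+ m + 1) * c = A%:Z * (-1) ^+ odd k.
    by rewrite {}Ec EAz; ring.
  by rewrite normrM normrX normrN1 expr1n mulr1.
(* An odd leader differs from the even n, so n - i is positive and the fixed point bound gives n - i
   >= A. *)
- move=> i /andP[i_odd lead]; have i_gt0 := odd_gt0 i_odd.
  have [i_le oi] := coset_leader_orbit_le q m q_odd q_gt1 m_gt0 i i_gt0 lead.
  have i_lt : (i < n)%N.
    by rewrite ltn_neqAle i_le andbT; apply: contraNneq n_even => <-.
  have j_gt0 : 0 < n%:Z - i%:Z by move: i_lt; clear; move: (n) => y; lia.
  have N_gt0 : 0 < q%:Z ^+ m + 1 by rewrite -(int_N q m) addn1.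
  have := orbit_le_fixed_point _ _ _ (isT : 1 < 2%:Z) N_gt0 j_gt0.
  have := orbit_le_fixed_point _ _ _ (q_gt1 : 1 < q%:Z) N_gt0 j_gt0 oi.
  rewrite EAz ler_pM2l => [A_le _|]; last by clear; lia.
  by move: A_le i_lt; clear; move: (n) => y; lia.
- have n_gt0 : (0 < n)%N by apply: leq_ltn_trans A_lt.
  (* From q^k = (-1)^k modulo q + 1 and (q + 1) A = N, the orbit of A is {A, -A}. *)
  have res k : (((n - A) * q ^ k) %% N = if odd k then n + A else n - A)%N.
    have [s Es] := half_sub_residue q m q_odd (n - A) k.
    have [c Ec] := expr_mod_succ q k.
    have eqz : n%:Z - (n - A)%N%:Z = A%:Z by move: A_lt; clear; move: (n) => y; lia.
    rewrite eqz in Es.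
    have Es2 : n%:Z - (((n - A) * q ^ k) %% N)%N%:Z =
        A%:Z * (-1) ^+ odd k + N%:Z * (c - s).
      by rewrite -Es (int_N q m) EAz {1}Ec; ring.
    have r_lt : (((n - A) * q ^ k) %% N < N)%N by rewrite ltn_mod addn1.
    move: Es2 r_lt A_lt N2 A_gt0; move: (_ %% _)%N (c - s); clear.
    move: (N) (n) => x y r v Er r_lt A_lt E2 A_gt0; rewrite E2 in Er r_lt.
    have [v_le0|v_gt0] := lerP v 0; last first.
      have : 0 <= y.*2%:Z * (v - 1) by apply: mulr_ge0; lia.
      by move: Er; case: (odd k); rewrite ?expr0 ?expr1; lia.
    have [v0|v_ne0] := eqVneq v 0.
      by move: Er; rewrite v0; case: (odd k); rewrite ?expr0 ?expr1; lia.
    have : 0 <= y.*2%:Z * (- v - 1) by apply: mulr_ge0; lia.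
    by move: Er; case: (odd k); rewrite ?expr0 ?expr1; lia.
  have lt1 : (n - A < N)%N by move: A_lt N2; clear; move: (n) (N) => y x; lia.
  have lt2 : (n + A < N)%N by move: A_lt N2; clear; move: (n) (N) => y x; lia.
  rewrite (_ : qcoset q N (n - A) = [set Ordinal lt1; Ordinal lt2]).
    rewrite cards2 -val_eqE /= neq_ltn (_ : (_ < _)%N) //.
    by move: A_gt0 n_gt0; clear; move: (n) => y; lia.
  apply/setP=> r; rewrite in_set2; apply/qcosetP/orP => // [[k Ek]|].
    have : r = (if odd k then n + A else n - A)%N :> nat by rewrite Ek res.
    by case: (odd k) => Er; [right | left]; apply/eqP/val_inj.
  by case=> /eqP ->; [exists 0%N | exists 1%N]; rewrite res.
- rewrite oddB; last by apply: ltnW; apply: ltn_trans T3n.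
  by rewrite (negbTE n_even) T2_odd; apply: orbit_le_coset_leader => //; apply: ltn_trans T3n.
- by move: T23 T3n AT2; clear; move: (n) => y; lia.
- move=> _; rewrite oddB; last by apply: ltnW.
  by rewrite (negbTE n_even) T3_odd; apply: orbit_le_coset_leader.
- move=> i lead /andP[i_ge i_lt].
  have i_ltn : (i < n)%N by apply: leq_trans i_lt (leq_subr _ _).
  apply: (full_coset_odd q m q_odd q_gt1 m_gt1 i T3) => //.
  apply/eqP; rewrite -[RHS]EA => /eqP; rewrite eqn_pmul2l; last by rewrite addn1.
  by move=> /eqP; move: i_lt A_lt; clear; move: (n) => y; lia.
Qed.

Lemma top_cosetsP : top_cosets (if (q ^ m %% 4 == 1)%N then 1%N else 2%N).
Proof.
rewrite -odd_half_N; case: ifPn.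
  exact: top_cosets_even_half.
exact: top_cosets_odd_half.
Qed.

End TopCosets.

(** * Frobenius and codes with prescribed zeros *)

Lemma lcmp_dvdp (K : fieldType) (p r s : {poly K}) :
  p != 0 -> (lcmp p r %| s) = (p %| s) && (r %| s).
Proof.
move=> p_neq0; rewrite /lcmp.
have g_neq0 : gcdp p r != 0 by rewrite gcdp_eq0 negb_and p_neq0.
have Ep : p %/ gcdp p r * gcdp p r = p by rewrite divpK ?dvdp_gcdl.
have Er : r %/ gcdp p r * gcdp p r = r by rewrite divpK ?dvdp_gcdr.
have cop : coprimep (p %/ gcdp p r) (r %/ gcdp p r).
  by apply: coprimep_div_gcd; rewrite p_neq0.
rewrite -divp_mulA ?dvdp_gcdr //.
move: (gcdp p r) (p %/ _) (r %/ _) g_neq0 Ep Er cop => g p1 r1 g_neq0 Ep Er cop.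
apply/idP/andP => [prs|[/dvdpP[s1 Es] rs]].
  split; apply: dvdp_trans prs; first exact: dvdp_mulr.
  by rewrite -Ep mulrAC -mulrA Er dvdp_mull.
rewrite Es [p * r1]mulrC dvdp_mul2r //.
move: rs; rewrite Es -[X in X %| _]Er -[X in _ %| _ * X]Ep mulrA dvdp_mul2r //.
by rewrite Gauss_dvdpl // coprimep_sym.
Qed.

Section Frobenius.
Variables (F : finFieldType) (L : fieldExtType F).
Local Notation q := #|F|.

Lemma frobeniusD (x y : L) : (x + y) ^+ q = x ^+ q + y ^+ q.
Proof.
have [p p_pr pcharFp] := finPcharP F.
have pcharLp : p \in [pchar L] by rewrite pchar_lalg.
apply: exprDn_pchar; rewrite (eq_pnat _ (pcharf_eq pcharLp)) -cardsT.
exact: abelem_pgroup (fin_ring_pchar_abelem pcharFp).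
Qed.

Definition frobenius (x : L) : L := x ^+ q.

Fact frobenius_is_zmod_morphism : zmod_morphism frobenius.
Proof.
move=> x y; apply: (addIr (frobenius y)).
by rewrite -frobeniusD !subrK.
Qed.

Fact frobenius_is_monoid_morphism : monoid_morphism frobenius.
Proof. by split=> [|x y]; rewrite /frobenius ?expr1n ?exprMn. Qed.

HB.instance Definition _ := GRing.isZmodMorphism.Build L L frobenius frobenius_is_zmod_morphism.
HB.instance Definition _ := GRing.isMonoidMorphism.Build L L frobenius frobenius_is_monoid_morphism.

Lemma frobenius_fixed (x : L) : (x \in 1%VS) = (frobenius x == x).
Proof. by rewrite Fermat's_little_theorem dimv1 expn1. Qed.

Lemma horner_frobenius (p : {poly F}) (x : L) :
  (map_poly (in_alg L) p).[x ^+ q] = (map_poly (in_alg L) p).[x] ^+ q.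
Proof.
rewrite -[RHS]/(frobenius _) -horner_map -map_poly_comp.
congr (_.[_]); apply: eq_map_poly => a /=.
by apply/esym/eqP; rewrite -frobenius_fixed rpredZ // rpred1.
Qed.

Lemma root_frobenius (p : {poly F}) (x : L) (k : nat) :
  root (map_poly (in_alg L) p) x -> root (map_poly (in_alg L) p) (x ^+ (q ^ k)).
Proof.
move=> px; elim: k => [|k IH]; first by rewrite expn0.
rewrite expnSr exprM /root horner_frobenius (eqP IH) expr0n.
by rewrite eqn0Ngt (ltnW (finNzRing_gt1 _)).
Qed.

End Frobenius.

Section ZeroSetCode.
Variables (F : finFieldType) (L : fieldExtType F) (N : nat) (beta : L).
Hypothesis beta_prim : N.-primitive_root beta.
Local Notation q := #|F|.
Local Notation wordL c := (map_poly (in_alg L) (word_poly c)).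

Lemma word_poly_rVpoly (n : nat) (c : 'rV[F]_n) : word_poly c = rVpoly c.
Proof.
apply/polyP => i; rewrite coef_rVpoly /word_poly coef_sum.
case: insubP => [j _ <-|].
  rewrite (bigD1 j) //= big1 ?addr0 => [|k ne_kj]; rewrite coefCM coefXn.
    by rewrite eqxx mulr1.
  by rewrite eq_sym (negbTE ne_kj : (_ == _ :> nat) = false) mulr0.
rewrite -leqNgt => n_le; apply: big1 => k _.
by rewrite coefCM coefXn gtn_eqF ?mulr0 // (leq_trans (ltn_ord k)).
Qed.

Definition vanishes_on (n : nat) (Z : {set 'I_N}) (c : 'rV[F]_n) : bool :=
  [forall r in Z, root (wordL c) (beta ^+ r)].

Definition mul_frobenius (r : 'I_N) : 'I_N :=
  Ordinal (ltn_pmod (r * q) (prim_order_gt0 beta_prim)).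

Definition zero_poly (Z : {set 'I_N}) : {poly L} :=
  \prod_(r in Z) ('X - (beta ^+ r)%:P).

Lemma zero_polyE (Z : {set 'I_N}) :
  zero_poly Z = \prod_(z <- [seq beta ^+ val r | r <- enum Z]) ('X - z%:P).
Proof. by rewrite big_map big_enum. Qed.

(** Coprimality makes multiplication by q injective, so it permutes the closed set Z, and Frobenius
    permutes the linear factors. The coefficients are therefore fixed by Frobenius. *)
Lemma zero_poly_over (Z : {set 'I_N}) :
  coprime q N -> (forall r, r \in Z -> mul_frobenius r \in Z) ->
  zero_poly Z \is a polyOver 1%VS.
Proof.
move=> cop_qN closedZ.
have inj : injective mul_frobenius.
  move=> a b /(congr1 val) /= /eqP eqab; apply/val_inj/eqP.
  wlog le_ab : a b eqab / (a <= b)%N.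
    move=> W; have [ab|/ltnW ba] := leqP a b; first exact: W.
    by rewrite eq_sym; apply: W; rewrite // eq_sym.
  rewrite eq_sym eqn_mod_dvd ?leq_mul // -mulnBl Gauss_dvdl 1?coprime_sym // in eqab.
  have [ba0|ba_gt0] := posnP (b - a)%N.
    by rewrite eqn_leq le_ab -subn_eq0 ba0.
  have := dvdn_leq ba_gt0 eqab.
  by rewrite leqNgt (leq_ltn_trans (leq_subr _ _)).
have imZ : mul_frobenius @: Z = Z.
  apply/eqP; rewrite eqEcard card_imset // leqnn andbT.
  by apply/subsetP => _ /imsetP[r rZ ->]; apply: closedZ.
have memZ r : (mul_frobenius r \in Z) = (r \in Z).
  by rewrite -{1}imZ mem_imset.
have fixed : map_poly (frobenius F L) (zero_poly Z) = zero_poly Z.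
  rewrite rmorph_prod [RHS](reindex_inj inj) /=; apply: eq_big => [r|r _].
    by rewrite memZ.
  by rewrite map_polyXsubC /= (prim_expr_mod beta_prim) exprM.
apply/polyOverP => i; rewrite frobenius_fixed.
by rewrite -{2}fixed coef_map.
Qed.

Lemma zero_poly_dvd (n : nat) (Z : {set 'I_N}) (c : 'rV[F]_n) :
  vanishes_on n Z c = (zero_poly Z %| wordL c).
Proof.
rewrite zero_polyE.
apply/forall_inP/idP => [roots|dvd r rZ].
  apply: uniq_roots_dvdp.
    by apply/allP => _ /mapP[r rZ ->]; apply: roots; rewrite mem_enum in rZ.
  rewrite uniq_rootsE map_inj_in_uniq ?enum_uniq // => a b _ _ /eqP.
  rewrite (eq_prim_root_expr beta_prim) !modn_small ?ltn_ord // => /eqP; exact: val_inj.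
rewrite -dvdp_XsubCl; apply: dvdp_trans dvd; rewrite dvdp_XsubCl root_prod_XsubC.
by apply: map_f; rewrite mem_enum.
Qed.

(** [zero_poly] descends to a polynomial g over F of degree |Z|, and the code is the injective image
    of h -> g h on polynomials h of degree less than n - |Z|. *)
Lemma dim_vanishes_on (n : nat) (Z : {set 'I_N}) :
  coprime q N -> (forall r, r \in Z -> mul_frobenius r \in Z) -> (#|Z| <= n)%N ->
  \dim <<[seq c <- enum 'rV[F]_n | vanishes_on n Z c]>> = (n - #|Z|)%N.
Proof.
move=> cop_qN closedZ le_n.
have /polyOver1P[g Eg] := zero_poly_over Z cop_qN closedZ.
have g_size : size g = #|Z|.+1.
  by rewrite -(size_map_poly (in_alg L)) -Eg zero_polyE size_prod_XsubC size_map -cardE.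
have g_neq0 : g != 0 by rewrite -size_poly_eq0 g_size.
have vanE (c : 'rV[F]_n) : vanishes_on n Z c = (g %| rVpoly c).
  by rewrite zero_poly_dvd Eg dvdp_map word_poly_rVpoly.
pose f (h : 'rV[F]_(n - #|Z|)) : 'rV[F]_n := poly_rV (g * rVpoly h).
have f_lin : linear f.
  by move=> a u v; rewrite /f linearP /= mulrDr -scalerAr linearP.
pose fl : {linear 'rV[F]_(n - #|Z|) -> 'rV[F]_n} :=
  HB.pack f (GRing.isLinear.Build F _ _ *:%R f f_lin).
have szM (h : 'rV[F]_(n - #|Z|)) : (size (g * rVpoly h)%R <= n)%N.
  apply: leq_trans (size_polyMleq _ _) _; rewrite g_size addSn /=.
  by rewrite -{2}(subnKC le_n) leq_add2l size_poly.
have fK (h : 'rV[F]_(n - #|Z|)) : rVpoly (f h) = g * rVpoly h.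
  by rewrite /f poly_rV_K.
have f_inj : lker (linfun fl) == 0%VS.
  apply/lker0P => u v; rewrite !lfunE /= => /(congr1 rVpoly).
  by rewrite !fK => /(mulfI g_neq0) /(can_inj rVpolyK).
transitivity (\dim (limg (linfun fl))).
  congr (\dim _); apply/eqP; rewrite eqEsubv; apply/andP; split.
    apply/span_subvP => c; rewrite mem_filter vanE => /andP[/dvdpP[h Eh] _].
    have h_size : (size h <= n - #|Z|)%N.
      have [->|h_neq0] := eqVneq h 0; first by rewrite size_poly0.
      have : (size (rVpoly c) <= n)%N by apply: size_poly.
      rewrite Eh size_mul // g_size addnS /= => le_hn.
      by rewrite -(leq_add2r #|Z|) subnK.
    apply/memv_imgP; exists (poly_rV h); rewrite ?memvf // lfunE /=.
    by apply: (can_inj rVpolyK); rewrite fK poly_rV_K // mulrC.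
  apply/subvP => _ /memv_imgP[h _ ->]; rewrite lfunE /=.
  apply: memv_span; rewrite mem_filter mem_enum andbT vanE fK.
  exact: dvdp_mulr.
rewrite limg_dim_eq ?(eqP f_inj) ?capv0 // dimvf dim_matrix; exact: mul1n.
Qed.

(* A combination of the vanishing sums isolates the coefficient at s0: take for weights
   the coefficients of the polynomial P with the other points of the support as roots. *)
Lemma weight_ge (n : nat) (c : 'rV[F]_n) (a : nat) (D : nat) :
  (n * 2 <= N)%N -> c != 0 ->
  (forall u, (u < D)%N -> root (wordL c) (beta ^+ (a + 2 * u))) ->
  (D < weight c)%N.
Proof.
move=> n_le c_neq0 roots; rewrite ltnNge; apply/negP => w_le.
have [s0 s0_supp] : exists s, c ord0 s != 0.
  apply/existsP; apply: contraR c_neq0; rewrite negb_exists => /forallP c0.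
  by apply/eqP/rowP => s; rewrite mxE; apply/eqP; have := c0 s; rewrite negbK.
pose S := [set s : 'I_n | c ord0 s != 0] :\ s0.
pose P := \prod_(s in S) ('X - (beta ^+ (2 * s))%:P).
(* P has [weight c - 1] roots, so its size is [weight c], and only the D prescribed zeros are
   needed. *)
have P_size : (size P <= D)%N.
  rewrite /P -big_enum size_prod_XsubC -cardE /S.
  by move: w_le; rewrite /weight (cardsD1 s0) inE s0_supp.
have sum0 : \sum_(s < n) (c ord0 s)%:A * beta ^+ (a * s) * P.[beta ^+ (2 * s)] = 0.
  under eq_bigr do rewrite horner_coef mulr_sumr.
  rewrite exchange_big /=; apply: big1 => u _.
  have := roots u (leq_trans (ltn_ord u) P_size); rewrite /root => /eqP root_u.
  transitivity (P`_u * (wordL c).[beta ^+ (a + 2 * u)]); last by rewrite root_u mulr0.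
  rewrite /word_poly rmorph_sum horner_sum mulr_sumr.
  apply: eq_bigr => s _; rewrite rmorphM /= map_polyC map_polyXn hornerM hornerC hornerXn.
  have E : beta ^+ (a * s) * (beta ^+ (2 * s)) ^+ u = (beta ^+ (a + 2 * u)) ^+ s.
    by rewrite -!exprM -exprD; congr (_ ^+ _); lia.
  by rewrite mulrCA -mulrA E.
have : (c ord0 s0)%:A * beta ^+ (a * s0) * P.[beta ^+ (2 * s0)] = 0.
  rewrite -[RHS]sum0 (bigD1 s0) //= big1 ?addr0 // => s ne_s.
  have [->|c_s] := eqVneq (c ord0 s) 0; first by rewrite scale0r !mul0r.
  rewrite /P (bigD1 s) ?inE ?ne_s //= hornerM hornerXsubC subrr mul0r mulr0 //.
apply/eqP; rewrite !mulf_neq0 //.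
- by rewrite scaler_eq0 oner_eq0 orbF.
- rewrite expf_neq0 //; apply/eqP => beta0.
  have := prim_expr_order beta_prim.
  rewrite beta0 expr0n gtn_eqF ?(prim_order_gt0 beta_prim) //= => /eqP.
  by rewrite eq_sym oner_eq0.
rewrite /P horner_prod; apply/prodf_neq0 => s; rewrite !inE => /andP[ne_s _].
rewrite hornerXsubC subr_eq0 (eq_prim_root_expr beta_prim).
have lt2 (r : 'I_n) : (2 * r < N)%N.
  by apply: leq_trans n_le; rewrite mulnC ltn_mul2r ltn_ord.
rewrite !modn_small // eqn_mul2l /=; apply: contra ne_s => /eqP eq_s.
by apply/eqP/val_inj.
Qed.

End ZeroSetCode.

(** * Dimension and weights of the BCH codes *)

Lemma big_lcmp_dvdp (K : fieldType) (I : Type) (r : seq I) (f : I -> {poly K}) (s : {poly K}) :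
  (forall i, f i != 0) ->
  (\big[@lcmp K/1]_(i <- r) f i %| s) = all (fun i => f i %| s) r.
Proof.
move=> f_neq0; elim: r => [|i r IH]; first by rewrite big_nil dvd1p.
by rewrite big_cons lcmp_dvdp //= IH.
Qed.

Lemma minPoly1_dvdp (F : fieldType) (L : fieldExtType F) (p : {poly F}) (x : L) :
  (minPoly 1%VS x %| map_poly (in_alg L) p) = root (map_poly (in_alg L) p) x.
Proof.
apply/idP/idP => [dvd|px].
  by rewrite -dvdp_XsubCl (dvdp_trans _ dvd) // dvdp_XsubCl root_minPoly.
by apply: minPoly_dvdp => //; apply/polyOver1P; exists p.
Qed.

Lemma in_bch_codeE (F : finFieldType) (L : fieldExtType F) (beta : L) (n dlt : nat) (c : 'rV[F]_n) :
  in_bch_code beta dlt c =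
  [forall j : 'I_dlt.-1, root (map_poly (in_alg L) (word_poly c)) (beta ^+ (2 * j + 1))].
Proof.
rewrite /in_bch_code /bch_generator big_lcmp_dvdp; last first.
  by move=> j; apply/monic_neq0/monic_minPoly.
apply/allP/forallP => [all_j j|all_j j _].
  by rewrite -minPoly1_dvdp; apply: all_j; rewrite mem_index_enum.
by rewrite minPoly1_dvdp.
Qed.

Lemma card_odd_ord (N n : nat) : N = n.*2 -> #|[set r : 'I_N | odd r]| = n.
Proof.
move->; rewrite -sum1dep_card -(big_mkord (fun r => odd r) (fun=> 1%N)).
elim: n => [|n IH]; first by rewrite big_geq.
by rewrite doubleS big_mkcond !big_nat_recr //= -big_mkcond IH odd_double addn0 addn1.
Qed.

(** * Partition of the odd residues into cosets *)

Section Cosets.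
Variables (q m : nat).
Hypotheses (q_odd : odd q) (q_gt1 : (1 < q)%N) (m_gt0 : (0 < m)%N).
Local Notation N := (q ^ m + 1)%N.
Local Notation odd_leader i := (odd i && coset_leader q N i).

Let qcosetP' := qcosetP q m q_odd q_gt1 m_gt0.

(** Provides the inverse of q^k as a power of q, which allows travelling backwards along a coset. *)
Lemma expn_period_mul (k : nat) : exists k', q ^ (k + k') = 1 %[mod N].
Proof.
exists (m.*2 * k - k)%N; rewrite subnKC; last by rewrite leq_pmull // double_gt0.
by rewrite expn_period // mulnC modnMl.
Qed.

Lemma odd_mod_N (r : nat) : odd (r %% N) = odd r.
Proof.
by rewrite {2}(divn_eq r N) oddD oddM (double_half_N q m q_odd) odd_double andbF.
Qed.

Lemma qcoset_odd (i : nat) (r : 'I_N) : odd i -> r \in qcoset q N i -> odd r.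
Proof. by move=> i_odd /qcosetP'[k ->]; rewrite odd_mod_N oddM oddX i_odd q_odd orbT. Qed.

Lemma qcoset_trans (i : nat) (r s : 'I_N) (k : nat) :
  (s = r * q ^ k %[mod N])%N -> (s \in qcoset q N i) = (r \in qcoset q N i).
Proof.
move=> Es; apply/qcosetP'/qcosetP' => [[a Ea]|[a Ea]]; last first.
  exists (a + k)%N.
  rewrite -(modn_small (ltn_ord s)) Es Ea modnMml -mulnA -expnD //.
have [k' Ek'] := expn_period_mul k.
exists (a + k')%N.
rewrite expnD mulnA -modnMml -Ea -(modn_small (ltn_ord s)) Es modnMml.
by rewrite -mulnA -expnD -modnMmr Ek' modnMmr muln1 modn_small.
Qed.

Lemma exists_coset_leader (r : 'I_N) :
  odd r -> exists i, odd_leader i /\ r \in qcoset q N i.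
Proof.
move=> r_odd; have N_gt0 : (0 < N)%N by rewrite addn1.
pose f (k : 'I_N) := ((r * q ^ k) %% N)%N.
have [k _ kmin] := arg_minnP f (isT : xpredT (Ordinal N_gt0)).
have fmin h : (f k <= (r * q ^ h) %% N)%N.
  have h_lt : (h %% m.*2 < N)%N.
    by apply: leq_trans (double_m_le q m q_odd q_gt1 m_gt0); rewrite ltn_mod double_gt0.
  rewrite -modnMmr (expn_period q m) // modnMmr.
  exact: (kmin (Ordinal h_lt)).
exists (f k); split.
  rewrite odd_mod_N oddM oddX r_odd q_odd orbT /=; apply/coset_leaderP => //.
  split; first by rewrite ltn_mod.
  by move=> h; rewrite modnMml -mulnA -expnD; apply: fmin.
have [k' Ek'] := expn_period_mul k.
apply/qcosetP'; exists k'.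
by rewrite modnMml -mulnA -expnD -modnMmr Ek' modnMmr muln1 modn_small.
Qed.

Lemma leader_le_qcoset (i : nat) (r : 'I_N) :
  coset_leader q N i -> r \in qcoset q N i -> (i <= r)%N.
Proof. by move=> /coset_leaderP[] // _ le_i /qcosetP'[k ->]. Qed.

Lemma qcoset_leader_inj (i j : nat) (r : 'I_N) :
  coset_leader q N i -> coset_leader q N j ->
  r \in qcoset q N i -> r \in qcoset q N j -> i = j.
Proof.
wlog le_ij : i j / (i <= j)%N.
  by move=> W li lj ri rj; have [ij|/ltnW ji] := leqP i j; [exact: W | apply/esym; exact: W].
move=> li lj ri rj; apply/eqP; rewrite eqn_leq le_ij /=.
have i_lt : (i < N)%N by case/coset_leaderP: li.
have ii : Ordinal i_lt \in qcoset q N i.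
  by apply/qcosetP'; exists 0%N; rewrite muln1 modn_small.
have [k Ek] := qcosetP' _ _ ri.
suff : Ordinal i_lt \in qcoset q N j by apply: leader_le_qcoset.
rewrite -(@qcoset_trans j (Ordinal i_lt) r k) //.
by rewrite [LHS](congr1 (fun x => x %% N)%N Ek) modn_mod.
Qed.

End Cosets.

Section BCHCode.
Variables (F : finFieldType) (L : fieldExtType F) (m : nat) (beta : L).
Local Notation q := #|F|.
Local Notation N := (q ^ m + 1)%N.
Local Notation n := (N %/ 2)%N.
Local Notation odd_leader i := (odd i && coset_leader q N i).
Local Notation delta := (delta q N).
Hypotheses (q_odd : odd q) (m_gt0 : (0 < m)%N) (beta_prim : N.-primitive_root beta).

Let q_gt1 : (1 < q)%N := finNzRing_gt1 F.
Let trans := qcoset_trans q m q_odd q_gt1 m_gt0.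
Let qcosetP' := qcosetP q m q_odd q_gt1 m_gt0.

(** The generator prescribes as zeros the odd exponents below 2 (dlt - 1). The last two hypotheses
    say that these include every odd leader below [delta i] and nothing from [delta i] on. *)
Variables (i dlt : nat).
Hypotheses (i_gt0 : (0 < i)%N)
  (delta_leader : forall k, (0 < k <= i)%N -> odd_leader (delta k))
  (delta_decr : forall j k, (0 < j < k)%N -> (k <= i)%N -> (delta k < delta j)%N)
  (leader_zero : forall r, odd_leader r -> (r < delta i)%N -> (r < 2 * dlt.-1)%N)
  (zero_lt : (2 * dlt.-1 <= delta i)%N).

Definition nonzeros : {set 'I_N} :=
  \bigcup_(k < i) qcoset q N (delta k.+1).

Definition zeros : {set 'I_N} := [set r : 'I_N | odd r] :\: nonzeros.

Lemma delta_ge (k : nat) : (0 < k <= i)%N -> (delta i <= delta k)%N.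
Proof.
move=> /andP[k_gt0]; rewrite leq_eqVlt => /predU1P[->//|k_lt].
by apply/ltnW/delta_decr; rewrite ?k_gt0.
Qed.

Lemma nonzeros_ge (r : 'I_N) : r \in nonzeros -> (delta i <= r)%N.
Proof.
case/bigcupP=> k _ rk; have k_le : (0 < k.+1 <= i)%N by rewrite ltn_ord.
have /andP[_ lead] := delta_leader _ k_le.
by apply: leq_trans (delta_ge _ k_le) _; apply: leader_le_qcoset rk.
Qed.

Lemma card_nonzeros : #|nonzeros| = (\sum_(k < i) #|qcoset q N (delta k.+1)|)%N.
Proof.
rewrite -sum1_card partition_disjoint_bigcup => [|a b ne_ab].
  by apply: eq_bigr => k _; rewrite sum1_card.
have lead (k : 'I_i) : odd_leader (delta k.+1) by apply: delta_leader; rewrite ltn_ord.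
have /andP[_ lead_a] := lead a; have /andP[_ lead_b] := lead b.
rewrite -setI_eq0; apply/eqP/setP => r; rewrite in_setI in_set0; apply/negP => /andP[ra rb].
have Eab := qcoset_leader_inj q m q_odd q_gt1 m_gt0 _ _ r lead_a lead_b ra rb.
have [lt|lt|/val_inj eq] := ltngtP a b.
- by have := delta_decr a.+1 b.+1 lt (ltn_ord b); rewrite Eab ltnn.
- by have := delta_decr b.+1 a.+1 lt (ltn_ord a); rewrite Eab ltnn.
by rewrite eq eqxx in ne_ab.
Qed.

Lemma nonzeros_trans (r s : 'I_N) (k : nat) :
  (s = r * q ^ k %[mod N])%N -> (s \in nonzeros) = (r \in nonzeros).
Proof.
move=> Es; apply/bigcupP/bigcupP => [[j _ sj]|[j _ rj]]; exists j => //.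
  by rewrite -(trans _ _ _ _ Es).
by rewrite (trans _ _ _ _ Es).
Qed.

Lemma card_zeros : (#|zeros| + #|nonzeros| = n)%N.
Proof.
have sub : nonzeros \subset [set r : 'I_N | odd r].
  apply/subsetP => r /bigcupP[k _ rk]; rewrite inE.
  have /andP[d_odd _] : odd_leader (delta k.+1) by apply: delta_leader; rewrite ltn_ord.
  exact: qcoset_odd rk.
rewrite /zeros cardsD (setIidPr sub) subnK ?subset_leq_card //.
by apply: card_odd_ord; apply: double_half_N.
Qed.

(** The coset of an odd r outside [nonzeros] has its leader below [delta i]; this leader is a
    prescribed exponent, and Frobenius carries the root to beta^r. Conversely, a prescribed exponent
    is less than [delta i], while all elements of [nonzeros] are at least [delta i]. *)
Lemma in_bch_code_vanishes (c : 'rV[F]_n) :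
  in_bch_code beta dlt c = vanishes_on F L N beta n zeros c.
Proof.
rewrite in_bch_codeE; apply/forallP/forall_inP => [roots r|roots j].
  rewrite !inE => /andP[r_nz r_odd].
  have [s [s_lead rs]] := exists_coset_leader q m q_odd q_gt1 m_gt0 r r_odd.
  have s_lt : (s < delta i)%N.
    rewrite ltnNge; apply: contra r_nz => s_ge.
    have [k [/andP[k_gt0 k_le] Es]] := delta_above q N s i i_gt0 s_lead s_ge.
    apply/bigcupP; case: k k_gt0 k_le Es => // k _ k_le Es.
    by exists (Ordinal k_le); rewrite //= -Es.
  have s_zero := leader_zero _ s_lead s_lt.
  have [k Ek] := qcosetP' _ _ rs.
  have s_odd : odd s by case/andP: s_lead.
  have j_lt : (s./2 < dlt.-1)%N by have := odd_double_half s; rewrite s_odd; lia.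
  have := roots (Ordinal j_lt); rewrite /= (_ : 2 * s./2 + 1 = s)%N; last first.
    by have := odd_double_half s; rewrite s_odd; lia.
  by move/(root_frobenius F L _ _ k); rewrite -exprM Ek (prim_expr_mod beta_prim).
have j_lt : (2 * j + 1 < delta i)%N by have := ltn_ord j; lia.
have d_lt : (delta i < N)%N.
  have := delta_leader i; rewrite i_gt0 leqnn => /(_ isT) /andP[_].
  by case/coset_leaderP.
have jN : (2 * j + 1 < N)%N by apply: ltn_trans d_lt.
have := roots (Ordinal jN); apply; rewrite !inE; apply/andP; split; last first.
  by rewrite /= addn1 oddS mul2n odd_double.
by apply/negP => /nonzeros_ge /=; rewrite leqNgt j_lt.
Qed.

Lemma dim_bch_code :
  \dim (bch_code beta n dlt) = (\sum_(k < i) #|qcoset q N (delta k.+1)|)%N.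
Proof.
rewrite /bch_code (eq_filter in_bch_code_vanishes) (dim_vanishes_on F L N beta beta_prim).
- by rewrite -card_nonzeros -card_zeros addKn.
- exact: coprime_q_N.
- move=> r; rewrite !inE => /andP[r_nz r_odd].
  rewrite (nonzeros_trans r _ 1) ?expn1 ?modn_mod // r_nz /=.
  by rewrite odd_mod_N // oddM r_odd q_odd.
by rewrite -card_zeros leq_addr.
Qed.

Lemma bch_code_weight (c : 'rV[F]_n) :
  in_bch_code beta dlt c -> c != 0 -> (delta i <= weight c)%N.
Proof.
rewrite in_bch_code_vanishes => /forall_inP vanish c_neq0.
have d_odd : odd (delta i) by have := delta_leader i; rewrite i_gt0 leqnn => /(_ isT) /andP[].
have d_lt : (delta i < N)%N.
  have := delta_leader i; rewrite i_gt0 leqnn => /(_ isT) /andP[_].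
  by case/coset_leaderP.
have N2 := double_half_N q m q_odd.
have small v : odd v -> (v < delta i)%N ->
    root (map_poly (in_alg L) (word_poly c)) (beta ^+ v).
  move=> v_odd v_lt; have vN : (v < N)%N by apply: ltn_trans d_lt.
  apply: (vanish (Ordinal vN)); rewrite !inE /= v_odd andbT.
  by apply/negP => /nonzeros_ge /=; rewrite leqNgt v_lt.
(* The starting exponent N - (delta_i - 2) represents -(delta_i - 2), and the delta_i - 1 exponents
   are all odd. If delta_i = 1, there are none to check. *)
have : ((delta i).-1 < weight c)%N.
  apply: (weight_ge F L N beta beta_prim n c (N - (delta i).-2)) => // [|u u_lt].
    by rewrite muln2 -N2.
  have [u_ge|u_lt'] := leqP (delta i).-1 (2 * u).
    have -> : (N - (delta i).-2 + 2 * u = (2 * u - (delta i).-2) + N)%N by lia.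
    rewrite exprD (prim_expr_order beta_prim) mulr1; apply: small; last by lia.
    by move: u_ge d_odd u_lt; clear; lia.
  pose v := ((delta i).-2 - 2 * u)%N.
  have v_odd : odd v by rewrite /v; move: d_odd u_lt' u_lt; clear; lia.
  have v_le : (v <= (delta i).-2)%N by apply: leq_subr.
  have -> : (N - (delta i).-2 + 2 * u = N - v)%N.
    by rewrite /v; move: u_lt' u_lt d_lt; clear; lia.
  have v_lt : (v < delta i)%N by rewrite /v; move: u_lt; clear; lia.
  (* The m-th iterate of Frobenius sends beta^v to beta^(-v), because v q^m = -v modulo N. *)
  have := root_frobenius F L _ _ m (small v v_odd v_lt).
  rewrite -exprM; congr (root _ _); apply/eqP; rewrite (eq_prim_root_expr beta_prim).
  rewrite -(eqn_modDr v) subnK; last by apply: ltnW; apply: ltn_trans d_lt.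
  by rewrite -{2}[v]muln1 -mulnDr modnn modnMl.
by rewrite prednK // odd_gt0.
Qed.

End BCHCode.

Theorem theorem32 (F : finFieldType) (L : fieldExtType F) (m l : nat) (alpha : L) :
  let q := #|F| in
  let N := (q ^ m + 1)%N in
  let n := (N %/ 2)%N in
  odd q -> (2 <= m)%N ->
  is_order_mod q N l -> \dim {: L} = l ->
  (q ^ l).-1.-primitive_root alpha ->
  let beta := alpha ^+ ((q ^ l).-1 %/ N) in
  let kappa := if (q ^ m %% 4 == 1)%N then 1%N else 2%N in
  (forall i dlt : nat, i \in [:: 1%N; 2%N] ->
     ((delta q N i.+1 + 3) %/ 2 <= dlt <= (delta q N i + 1) %/ 2)%N ->
     (2 <= dlt <= n)%N ->
     \dim (bch_code beta n dlt) = (2 * m * (i - 1) + kappa)%N /\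
     (forall c : 'rV[F]_n, in_bch_code beta dlt c -> c != 0 ->
        (delta q N i <= weight c)%N))
  /\
  ((25 <= q ^ m)%N ->
     let dlt := ((delta q N 3 + 1) %/ 2)%N in
     \dim (bch_code beta n dlt) = (4 * m + kappa)%N /\
     (forall c : 'rV[F]_n, in_bch_code beta dlt c -> c != 0 ->
        (delta q N 3 <= weight c)%N)).
Proof.
move=> q N n q_odd m_gt1 [_ [l_ord _]] _ alpha_prim beta kappa.
have q_gt1 : (1 < q)%N := finNzRing_gt1 F.
have m_gt0 : (0 < m)%N by apply: ltnW.
have beta_prim : N.-primitive_root beta.
  apply: dvdn_prim_root alpha_prim _ _.
  by rewrite -subn1 -eqn_mod_dvd ?expn_gt0 ?(ltnW q_gt1) //; apply/eqP.
have [lead1 card1 [lead2 d21 card2] top3] := top_cosetsP q m q_odd q_gt1 m_gt1.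
(* An odd leader below delta_i is at most delta_(i+1), and the lower limit on [dlt] gives 2 (dlt -
   1) > delta_(i+1). *)
have below i dlt : (0 < i)%N -> ((delta q N i.+1 + 3) %/ 2 <= dlt)%N ->
    forall r, odd r && coset_leader q N r -> (r < delta q N i)%N -> (r < 2 * dlt.-1)%N.
  move=> i_gt0 dlt_ge r r_lead r_lt.
  have [/andP[d_odd _] r_le _] := delta_next q N r i i_gt0 r_lead r_lt.
  by move: d_odd r_le dlt_ge; clear; lia.
split.
  move=> i dlt i_in /andP[dlt_ge dlt_le] _.
  have i_gt0 : (0 < i)%N by case: i i_in {dlt_ge dlt_le}.
  have i_le : (i <= 2)%N by case: i i_in {dlt_ge dlt_le i_gt0} => [|[|[]]].
  have leader k : (0 < k <= i)%N -> odd (delta q N k) && coset_leader q N (delta q N k).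
    move=> /andP[k_gt0 k_le]; have := leq_trans k_le i_le.
    by case: k k_gt0 {k_le} => [|[|[]]].
  have decr j k : (0 < j < k)%N -> (k <= i)%N -> (delta q N k < delta q N j)%N.
    move=> jk k_le; have := leq_trans k_le i_le.
    by case: k jk {k_le} => [|[|[]]] //; case: j => [|[]].
  have dlt_le2 : (2 * dlt.-1 <= delta q N i)%N.
    by move: dlt_le; clear; move: (delta q N i) => d; lia.
  have zero := below i dlt i_gt0 dlt_ge.
  split; last first.
    by move=> c; apply: (bch_code_weight F L m beta q_odd m_gt0 beta_prim i dlt).
  rewrite (dim_bch_code F L m beta q_odd m_gt0 beta_prim i dlt) //.
  case: i i_in {i_gt0 i_le leader decr dlt_le2 zero dlt_ge dlt_le} => [|[|[|]]] // _.
    by rewrite big_ord_recl big_ord0 card1 muln0 addn0.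
  by rewrite !big_ord_recl big_ord0 card1 card2 addn0 muln1 addnC mul2n.
move=> /top3[lead3 d32 card3] dlt.
have leader k : (0 < k <= 3)%N -> odd (delta q N k) && coset_leader q N (delta q N k).
  by case: k => [|[|[|[]]]].
have decr j k : (0 < j < k)%N -> (k <= 3)%N -> (delta q N k < delta q N j)%N.
  case: k => [|[|[|[]]]] //; case: j => [|[|[]]] // _ _; exact: ltn_trans d32 d21.
have d3_odd : odd (delta q N 3) by case/andP: lead3.
have dlt_le : (2 * dlt.-1 <= delta q N 3)%N.
  by rewrite /dlt; move: d3_odd; clear; move: (delta q N 3) => d; lia.
(* Here 2 (dlt - 1) = delta_3 - 1, so every odd number below delta_3 is a prescribed exponent and no
   fourth leader enters. *)
have zero r : odd r && coset_leader q N r -> (r < delta q N 3)%N -> (r < 2 * dlt.-1)%N.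
  by move=> /andP[r_odd _]; rewrite /dlt; move: d3_odd r_odd; clear; move: (delta q N 3) => d; lia.
split; last first.
  by move=> c; apply: (bch_code_weight F L m beta q_odd m_gt0 beta_prim 3 dlt).
rewrite (dim_bch_code F L m beta q_odd m_gt0 beta_prim 3 dlt) //.
rewrite !big_ord_recl big_ord0 card1 card2 card3 /kappa; clear.
by case: ifP => _; lia.
Qed.
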